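(* If $E$ is a finite dimensional Banach space, then the elementary class of $E\oplus_2\ell_2$ consists exactly (up to linear isometry) of all spaces $E\oplus_2H$, where $H$ is any infinite dimensional Hilbert space. Therefore the elementary class of $E\oplus_2\ell_2$ is totally categorical, i.e. it is $\kappa$-categorical for every infinite cardinal number $\kappa$.
   Context: Banach spaces are over $\mathbb K\in\{\mathbb R,\mathbb C\}$. $X\oplus_2Y$ is the direct sum with norm $\|x+y\|^2=\|x\|^2+\|y\|^2$. Banach spaces $X,Y$ are elementarily equivalent if there are ultrafilters $\mathcal U,\mathcal V$ (on some sets) such that the Banach space ultrapowers $X_{\mathcal U}$ and $Y_{\mathcal V}$ are linearly isometric (this is an equivalence relation). The elementary class of $X$ is the class of all Banach spaces elementarily equivalent to $X$. For an infinite cardinal $\kappa$, the elementary class of an infinite dimensional Banach space is $\kappa$-categorical if it contains, up to linear isometry, exactly one space of density character $\kappa$. *)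

(* Defs.v *)
From HB Require Import structures.
From mathcomp Require Import all_boot all_order all_algebra.
From mathcomp Require Import complex ring.
From mathcomp Require Import all_classical reals topology normedtype sequences.

Set Implicit Arguments.
Unset Strict Implicit.
Unset Printing Implicit Defensive.
Import Order.TTheory GRing.Theory Num.Theory.
Import numFieldNormedType.Exports.
Local Open Scope classical_set_scope.
Local Open Scope ring_scope.
Local Open Scope quotient_scope.
Local Open Scope card_scope.

Variant scalar_kind := real_scalars | complex_scalars.

Section Scalars.
Variable R : realType.

Definition scalars (k : scalar_kind) : numFieldType :=
  match k with
  | real_scalars => R
  | complex_scalars => R[i] : numFieldType
  end.

Definition real_part (k : scalar_kind) : scalars k -> R :=
  match k return scalars k -> R with
  | real_scalars => id
  | complex_scalars => @complex.Re R
  end.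

Definition of_real (k : scalar_kind) : R -> scalars k :=
  match k return R -> scalars k with
  | real_scalars => id
  | complex_scalars => fun x => real_complex R x
  end.

Definition conjugate (k : scalar_kind) : scalars k -> scalars k :=
  match k return scalars k -> scalars k with
  | real_scalars => id
  | complex_scalars => @conjc R
  end.

End Scalars.
Arguments real_part {R k} z : rename.
Arguments of_real {R} k x : rename.
Arguments conjugate {R k} z : rename.

Section ScalarsTheory.
Variables (R : realType) (k : scalar_kind).
Implicit Types x y : R.
Local Notation K := (scalars R k).
Local Notation "x %:K" := (of_real k x) (at level 2, format "x %:K").

Lemma of_realK x : real_part x%:K = x. Proof. by case: k. Qed.
Lemma of_real0 : of_real k (0 : R) = 0. Proof. by case: k. Qed.
Lemma of_realD x y : (x + y)%:K = x%:K + y%:K.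
Proof. by case: k => //=; exact: rmorphD. Qed.
Lemma of_realM x y : (x * y)%:K = x%:K * y%:K.
Proof. by case: k => //=; exact: rmorphM. Qed.
Lemma ler_of_real x y : (x%:K <= y%:K) = (x <= y).
Proof. by case: k => //=; exact: lecR. Qed.
Lemma ltr_of_real x y : (x%:K < y%:K) = (x < y).
Proof. by case: k => //=; exact: ltcR. Qed.
Lemma of_real_ge0 (z : K) : 0 <= z -> (real_part z)%:K = z.
Proof. by case: k z => //= z z0; rewrite RRe_real// ger0_real. Qed.
Lemma real_partD (z w : K) : real_part (z + w) = real_part z + real_part w.
Proof. by case: k z w => //= -[? ?] [? ?]. Qed.
Lemma real_part_le (z w : K) : z <= w -> real_part z <= real_part w.
Proof. by case: k z w => //= z w; rewrite lecE => /andP[]. Qed.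

End ScalarsTheory.

(* Norms of a [normedModType K] take values in K; [rnorm] is the same norm with
   values in R, see [rnormE]. *)
Definition rnorm (R : realType) (k : scalar_kind)
  (X : normedModType (scalars R k)) (x : X) : R := real_part `|x|.

Section RealNorm.
Variables (R : realType) (k : scalar_kind).
Local Notation K := (scalars R k).
Implicit Type X : normedModType K.

Lemma rnormE X (x : X) : of_real k (rnorm x) = `|x|.
Proof. exact: of_real_ge0. Qed.

Lemma rnorm_ge0 X (x : X) : 0 <= rnorm x.
Proof. by rewrite -(ler_of_real k) rnormE of_real0. Qed.

Lemma rnormD X (x y : X) : rnorm (x + y) <= rnorm x + rnorm y.
Proof. by rewrite -(ler_of_real k) of_realD !rnormE ler_normD. Qed.

Lemma rnormN X (x : X) : rnorm (- x) = rnorm x.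
Proof. by rewrite /rnorm normrN. Qed.

Lemma rnorm0 X : rnorm (0 : X) = 0.
Proof. by rewrite /rnorm normr0 -(of_real0 R k) of_realK. Qed.

Lemma rnormB X (x y : X) : rnorm (x - y) = rnorm (y - x).
Proof. by rewrite -rnormN opprB. Qed.

Lemma rnorm0_eq0 X (x : X) : rnorm x = 0 -> x = 0.
Proof. by move=> x0; apply/normr0_eq0; rewrite -rnormE x0 of_real0. Qed.

Lemma rnormZ X (a : K) (x : X) : rnorm (a *: x) = real_part `|a| * rnorm x.
Proof.
apply: (can_inj (of_realK k)).
by rewrite of_realM rnormE of_real_ge0// rnormE normrZ.
Qed.

Lemma cvg_to_rnorm X (F : set_system X) {FF : Filter F} (l : X) :
  (forall e : R, 0 < e -> F [set x | rnorm (l - x) <= e]) -> F --> l.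
Proof.
move=> Fl; apply/cvgrPdist_le => e e0.
have e0' : 0 < real_part e by rewrite -(ltr_of_real k) of_real_ge0 ?of_real0 ?ltW.
apply: filterS (Fl _ e0') => x /=.
by rewrite -(ler_of_real k) rnormE of_real_ge0 // ltW.
Qed.

Lemma cvg_rnorm X (F : set_system X) {FF : Filter F} (l : X) :
  F --> l -> forall e : R, 0 < e -> F [set x | rnorm (l - x) <= e].
Proof.
move=> /cvgrPdist_le Fl e e0.
have e0' : 0 < of_real k e by rewrite -(of_real0 R k) ltr_of_real.
by apply: filterS (Fl _ e0') => x /=; rewrite -rnormE ler_of_real.
Qed.

Lemma cauchy_rnorm X (F : set_system X) {FF : ProperFilter F} :
  cauchy F <-> forall e : R, 0 < e ->
    exists2 A, F A & forall x y, A x -> A y -> rnorm (x - y) <= e.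
Proof.
split=> [/cauchy_ballP Fc e e0|Fc].
  have e0' : 0 < of_real k e by rewrite -(of_real0 R k) ltr_of_real.
  have [[A B] /= [FA FB] AB] := Fc _ e0'.
  exists (A `&` B); first exact: filterI.
  move=> x y [Ax _] [_ By].
  rewrite -(ler_of_real k) rnormE ltW//.
  have /= := AB (x, y) (conj Ax By).
  by rewrite -ball_normE.
apply/cauchy_ballP => e e0.
have e1 : 0 < real_part e by rewrite -(ltr_of_real k) of_real_ge0 ?of_real0 ?ltW.
have e0' : 0 < real_part e / 2 by rewrite divr_gt0.
have [A FA Ae] := Fc _ e0'.
exists (A, A) => // -[x y] /= [Ax Ay].
rewrite -ball_normE /= -rnormE -[e]of_real_ge0 ?ltW// ltr_of_real.
apply: le_lt_trans (Ae _ _ Ax Ay) _.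
by rewrite ltr_pdivrMr// ltr_pMr ?ltr1n.
Qed.

End RealNorm.

Lemma sqrtr_le_normD (R : rcfType) (u v : R) :
  Num.sqrt (u ^+ 2 + v ^+ 2) <= `|u| + `|v|.
Proof.
have uv0 : 0 <= `|u| + `|v| by rewrite addr_ge0.
rewrite -[leRHS]ger0_norm// -[leRHS]sqrtr_sqr ler_wsqrtr//.
rewrite sqrrD !real_normK ?num_real// addrAC lerDl.
by rewrite mulrn_wge0// mulr_ge0.
Qed.

Lemma scalars_complete (R : realType) (k : scalar_kind)
  (F : set_system (scalars R k)^o) : ProperFilter F -> cauchy F -> cvg F.
Proof.
case: k F => F FF; first exact: (@R_complete R F).
move=> /cauchy_rnorm Fc.
have rnormCE (z : (scalars R complex_scalars)^o) : rnorm z = Normc.normc (z : R[i]).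
  by [].
have Re_le (z : R[i]) : `|complex.Re z| <= Normc.normc z.
  by case: z => a b /=; rewrite -sqrtr_sqr ler_wsqrtr// lerDl sqr_ge0.
have Im_le (z : R[i]) : `|complex.Im z| <= Normc.normc z.
  by case: z => a b /=; rewrite -sqrtr_sqr ler_wsqrtr// lerDr sqr_ge0.
have part_cvg (p : R[i] -> R) : (forall z w, p (z - w) = p z - p w) ->
    (forall z, `|p z| <= Normc.normc z) -> cvg (p @ F).
  move=> pB ple; apply: R_complete; apply/(@cauchy_rnorm R real_scalars R^o).
  move=> e /Fc[A FA Ae]; exists (p @` A).
    by apply: (@filterS _ F _ A) => // z Az; exists z.
  move=> _ _ [z Az <-] [w Aw <-]; apply: le_trans (Ae _ _ Az Aw).
  by rewrite rnormCE -[rnorm _]/(`|p z - p w|) -pB.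
have BRe (z w : R[i]) : complex.Re (z - w) = complex.Re z - complex.Re w.
  by case: z w => [? ?] [? ?].
have /cvg_ex[/= a Fa] := part_cvg _ BRe Re_le.
have BIm (z w : R[i]) : complex.Im (z - w) = complex.Im z - complex.Im w.
  by case: z w => [? ?] [? ?].
have /cvg_ex[/= b Fb] := part_cvg _ BIm Im_le.
apply/cvg_ex; exists (Complex a b); apply: (@cvg_to_rnorm R complex_scalars (scalars R complex_scalars)^o F) => e e0.
have e20 : 0 < e / 2 by rewrite divr_gt0.
move/cvgrPdist_le : Fa => /(_ _ e20) Fa.
move/cvgrPdist_le : Fb => /(_ _ e20) Fb.
apply: filterS2 Fa Fb => -[c d] /= ac bd.
rewrite (splitr e); exact: le_trans (sqrtr_le_normD _ _) (lerD ac bd).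
Qed.

Lemma ultra_is_cvg (R : realType) (I : Type) (U : set_system I)
    (UU : UltraFilter U) (f : I -> R) (a b : R) :
  (forall i, a <= f i <= b) -> cvg (f @ U).
Proof.
move=> fab.
have [|p [_ clp]] := @segment_compact R a b (f @ U) (fmap_proper_filter f _).
  by apply: (@filterE _ U) => i /=; rewrite in_itv; exact: fab.
apply/cvg_ex; exists p => N Np.
have [//|UN] := in_ultra_setVsetC (f @^-1` N) UU.
by have [x [/= nNx Nx]] := clp (~` N) N UN Np.
Qed.

Section BoundedFamilies.
Variables (R : realType) (k : scalar_kind) (I : Type).
Variable X : normedModType (scalars R k).

Definition bounded_family : {pred I -> X} :=
  fun x => `[< exists M : R, forall i, rnorm (x i) <= M >].

Lemma bounded_family_closed : GRing.subsemimod_closed bounded_family.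
Proof.
split; first split.
- by apply/asboolP; exists 0 => i; rewrite rnorm0.
- move=> x y /asboolP[M xM] /asboolP[N yN]; apply/asboolP; exists (M + N) => i.
  exact: le_trans (rnormD _ _) (lerD (xM i) (yN i)).
- move=> a x /asboolP[M xM]; apply/asboolP; exists (real_part `|a| * M) => i.
  by rewrite rnormZ ler_wpM2l// (rnorm_ge0 (a : (scalars R k)^o)).
Qed.

Record linfty :=
  Linfty { linfty_val :> I -> X; linftyP : linfty_val \in bounded_family }.

HB.instance Definition _ := [isSub for linfty_val].
HB.instance Definition _ := [Choice of linfty by <:].
HB.instance Definition _ := GRing.SubChoice_isSubLmodule.Build _ _ _ linfty
  bounded_family_closed.

End BoundedFamilies.

Section Ultrapower.
Variables (R : realType) (k : scalar_kind) (I : Type) (U : set_system I).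
Hypothesis UU : UltraFilter U.
Variable X : normedModType (scalars R k).
Local Notation linfty := (linfty I X).

(* The limit exists for every bounded family, see [ultraseminorm_cvg]. *)
Definition ultraseminorm (x : linfty) : R := lim (rnorm (x i) @[i --> U]).

Lemma ultraseminorm_cvg (x : linfty) :
  rnorm (x i) @[i --> U] --> ultraseminorm x.
Proof.
have /asboolP[M xM] := linftyP x.
apply: (@ultra_is_cvg _ _ _ UU _ 0 M) => i.
by rewrite rnorm_ge0 xM.
Qed.
Arguments ultraseminorm_cvg : clear implicits.

Lemma ultraseminorm_eq (x : linfty) l :
  rnorm (x i) @[i --> U] --> l -> ultraseminorm x = l.
Proof. exact: cvg_lim. Qed.

Lemma ultraseminorm0 : ultraseminorm 0 = 0.
Proof.
apply: ultraseminorm_eq.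
rewrite (_ : (fun _ => _) = cst 0); first exact: cvg_cst.
by apply/funext => i; rewrite /= rnorm0.
Qed.

Lemma ultraseminorm_ge0 x : 0 <= ultraseminorm x.
Proof.
apply: (cvgr_to_ge (ultraseminorm_cvg x)).
by apply: filterE => i; exact: rnorm_ge0.
Qed.

Lemma ultraseminormD x y :
  ultraseminorm (x + y) <= ultraseminorm x + ultraseminorm y.
Proof.
rewrite -subr_ge0; apply: (cvgr_to_ge (cvgB (cvgD (ultraseminorm_cvg x)
  (ultraseminorm_cvg y)) (ultraseminorm_cvg (x + y)))).
by apply: filterE => i; rewrite subr_ge0; exact: rnormD.
Qed.

Lemma ultraseminormZ a x :
  ultraseminorm (a *: x) = real_part `|a| * ultraseminorm x.
Proof.
apply: ultraseminorm_eq; under eq_fun do rewrite rnormZ.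
exact: cvgMr (ultraseminorm_cvg _).
Qed.

Definition null_family : {pred linfty} := fun x => ultraseminorm x == 0.

Lemma null_family_zmod_closed : zmod_closed null_family.
Proof.
split=> [|x y /eqP x0 /eqP y0]; first exact/eqP/ultraseminorm0.
apply/eqP/le_anti; rewrite ultraseminorm_ge0 andbT.
rewrite (le_trans (ultraseminormD _ _))// -scaleN1r ultraseminormZ x0 y0.
by rewrite mulr0 addr0.
Qed.

HB.instance Definition _ :=
  GRing.isZmodClosed.Build linfty null_family null_family_zmod_closed.

(* [Quotient.quot] only carries the additive group structure; the K-module
   structure and the norm [x] |-> lim_U |x i| are added below. *)
Definition ultrapower := Quotient.quot null_family.

HB.instance Definition _ := GRing.Zmodule.on ultrapower.
HB.instance Definition _ := EqQuotient.on ultrapower.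

Local Notation pi := (\pi_ultrapower).

Lemma pi_ultrapowerP (x y : linfty) : pi x = pi y <-> ultraseminorm (x - y) = 0.
Proof. by split=> [/eqmodP/eqP|xy]; last exact/eqmodP/eqP. Qed.

Lemma pi_ultrapowerD (x y : linfty) : pi (x + y) = pi x + pi y.
Proof. by rewrite [LHS]Quotient.pi_add. Qed.

Lemma pi_ultrapower0 : pi 0 = 0.
Proof. by apply: (addrI (pi 0)); rewrite -pi_ultrapowerD !addr0. Qed.

Definition ultrapower_scale (a : scalars R k) (q : ultrapower) : ultrapower :=
  pi (a *: repr q).

Lemma pi_ultrapowerZ a (x : linfty) : pi (a *: x) = ultrapower_scale a (pi x).
Proof.
apply/pi_ultrapowerP; rewrite -scalerBr ultraseminormZ.
have /pi_ultrapowerP -> : pi x = pi (repr (pi x)) by rewrite reprK.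
by rewrite mulr0.
Qed.

Lemma ultrapower_scaleA a b q :
  ultrapower_scale a (ultrapower_scale b q) = ultrapower_scale (a * b) q.
Proof.
rewrite -[q]reprK -(pi_ultrapowerZ b) -(pi_ultrapowerZ a).
by rewrite -(pi_ultrapowerZ (a * b)) scalerA.
Qed.

Lemma ultrapower_scale1 : left_id 1 ultrapower_scale.
Proof. by move=> q; rewrite -[q]reprK -pi_ultrapowerZ scale1r. Qed.

Lemma ultrapower_scaleDr : right_distributive ultrapower_scale +%R.
Proof.
move=> a p q; rewrite -[p]reprK -[q]reprK -pi_ultrapowerD -!pi_ultrapowerZ.
by rewrite scalerDr pi_ultrapowerD.
Qed.

Lemma ultrapower_scaleDl q : {morph ultrapower_scale^~ q : a b / a + b}.
Proof.
by move=> a b; rewrite -[q]reprK -!pi_ultrapowerZ scalerDl pi_ultrapowerD.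
Qed.

HB.instance Definition _ := GRing.Zmodule_isLmodule.Build (scalars R k)
  ultrapower ultrapower_scaleA ultrapower_scale1 ultrapower_scaleDr
  ultrapower_scaleDl.

Definition ultrapower_norm (q : ultrapower) : scalars R k :=
  of_real k (ultraseminorm (repr q)).

Lemma ultrapower_norm_pi (x : linfty) :
  ultrapower_norm (pi x) = of_real k (ultraseminorm x).
Proof.
congr of_real; have /pi_ultrapowerP := reprK (pi x); set y := repr _ => yx0.
have xy0 : ultraseminorm (x - y) = 0.
  have := ultraseminormZ (-1) (y - x); rewrite scaleN1r opprB => ->.
  by rewrite yx0 mulr0.
apply/le_anti/andP; split.
  by have := ultraseminormD (y - x) x; rewrite subrK yx0 add0r.
by have := ultraseminormD (x - y) y; rewrite subrK xy0 add0r.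
Qed.

Lemma ultrapower_normD p q :
  ultrapower_norm (p + q) <= ultrapower_norm p + ultrapower_norm q.
Proof.
rewrite -[p]reprK -[q]reprK -pi_ultrapowerD !ultrapower_norm_pi.
by rewrite -of_realD ler_of_real ultraseminormD.
Qed.

Lemma ultrapower_normZ a q :
  ultrapower_norm (a *: q) = `|a| * ultrapower_norm q.
Proof.
rewrite -[q]reprK -[a *: _]pi_ultrapowerZ !ultrapower_norm_pi.
by rewrite ultraseminormZ of_realM of_real_ge0.
Qed.

Lemma ultrapower_norm0_eq0 q : ultrapower_norm q = 0 -> q = 0.
Proof.
rewrite -[q]reprK ultrapower_norm_pi -(of_real0 R k).
move=> /(can_inj (of_realK k)) q0.
by rewrite -pi_ultrapower0; apply/pi_ultrapowerP; rewrite subr0.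
Qed.

HB.instance Definition _ := Lmodule_isNormed.Build (scalars R k) ultrapower
  ultrapower_normD ultrapower_normZ ultrapower_norm0_eq0.

End Ultrapower.

Section Hypotenuse.
Variable R : rcfType.
Implicit Types a b c d : R.

Definition hypot a b : R := Num.sqrt (a ^+ 2 + b ^+ 2).

Lemma hypot_ge0 a b : 0 <= hypot a b. Proof. exact: sqrtr_ge0. Qed.

Lemma sqr_hypot a b : hypot a b ^+ 2 = a ^+ 2 + b ^+ 2.
Proof. by rewrite sqr_sqrtr// addr_ge0 ?sqr_ge0. Qed.

Lemma ler_hypot a b c d :
  0 <= a -> 0 <= b -> a <= c -> b <= d -> hypot a b <= hypot c d.
Proof.
move=> a0 b0 ac bd; apply: ler_wsqrtr.
by rewrite lerD// ler_sqr// nnegrE (le_trans _ ac, le_trans _ bd).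
Qed.

Lemma hypotD a b c d : hypot (a + c) (b + d) <= hypot a b + hypot c d.
Proof.
have abcd : a * c + b * d <= hypot a b * hypot c d.
  rewrite (le_trans (ler_norm _))// -sqrtr_sqr -sqrtrM ?addr_ge0 ?sqr_ge0//.
  apply: ler_wsqrtr; rewrite -subr_ge0.
  rewrite (_ : _ - _ = (a * d - b * c) ^+ 2) ?sqr_ge0//.
  by rewrite !expr2; ring.
rewrite -[leRHS]ger0_norm ?addr_ge0 ?hypot_ge0// -[leRHS]sqrtr_sqr.
apply: ler_wsqrtr; rewrite !sqrrD !sqr_hypot.
rewrite [leLHS](_ : _ = a ^+ 2 + b ^+ 2 + (a * c + b * d) *+ 2
  + (c ^+ 2 + d ^+ 2)); last by ring.
by rewrite lerD2r lerD2l lerMn2r.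
Qed.

Lemma hypot_ler_norm a b : hypot a b <= `|a| + `|b|.
Proof. exact: sqrtr_le_normD. Qed.

Lemma ler_hypotl a b : 0 <= a -> a <= hypot a b.
Proof.
move=> a0; rewrite -[leLHS]ger0_norm// -sqrtr_sqr.
by apply: ler_wsqrtr; rewrite lerDl sqr_ge0.
Qed.

Lemma ler_hypotr a b : 0 <= b -> b <= hypot a b.
Proof. by rewrite /hypot addrC; exact: ler_hypotl. Qed.

Lemma hypotM a b c : 0 <= a -> hypot (a * b) (a * c) = a * hypot b c.
Proof.
move=> a0; rewrite /hypot !exprMn -mulrDr sqrtrM ?sqr_ge0//.
by rewrite sqrtr_sqr ger0_norm.
Qed.

End Hypotenuse.

Section DirectSum2.
Variables (R : realType) (k : scalar_kind) (X Y : normedModType (scalars R k)).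

(* An alias of X * Y, whose library norm is the maximum norm. *)
Definition dsum2 : Type := (X * Y)%type.

HB.instance Definition _ := GRing.Lmodule.copy dsum2 (X * Y)%type.

Definition dsum2_norm (z : dsum2) : scalars R k :=
  of_real k (Num.sqrt (rnorm z.1 ^+ 2 + rnorm z.2 ^+ 2)).

Lemma dsum2_normE z : dsum2_norm z = of_real k (hypot (rnorm z.1) (rnorm z.2)).
Proof. by []. Qed.

Lemma dsum2_normD z w : dsum2_norm (z + w) <= dsum2_norm z + dsum2_norm w.
Proof.
rewrite !dsum2_normE -of_realD ler_of_real.
by apply: le_trans (hypotD _ _ _ _); rewrite ler_hypot ?rnorm_ge0 ?rnormD.
Qed.

Lemma dsum2_normZ a z : dsum2_norm (a *: z) = `|a| * dsum2_norm z.
Proof.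
rewrite !dsum2_normE /= !rnormZ hypotM ?of_realM ?of_real_ge0//.
exact: (rnorm_ge0 (a : (scalars R k)^o)).
Qed.

Lemma dsum2_norm0_eq0 z : dsum2_norm z = 0 -> z = 0.
Proof.
rewrite dsum2_normE -(of_real0 R k) => /(can_inj (of_realK k)) z0.
case: z z0 => x y /= xy0; congr pair; apply/rnorm0_eq0/le_anti.
  by rewrite rnorm_ge0 andbT -xy0 ler_hypotl ?rnorm_ge0.
by rewrite rnorm_ge0 andbT -xy0 ler_hypotr ?rnorm_ge0.
Qed.

HB.instance Definition _ := Lmodule_isNormed.Build (scalars R k) dsum2
  dsum2_normD dsum2_normZ dsum2_norm0_eq0.

Lemma rnorm_dsum2 (z : dsum2) : rnorm z = hypot (rnorm z.1) (rnorm z.2).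
Proof. exact: of_realK. Qed.

End DirectSum2.

Section DirectSum2Complete.
Variables (R : realType) (k : scalar_kind).
Variables (X Y : completeNormedModType (scalars R k)).

Lemma dsum2_complete (F : set_system (dsum2 X Y)) :
  ProperFilter F -> cauchy F -> cvg F.
Proof.
move=> FF /cauchy_rnorm Fc.
have cvg1 : cvg ((fun z : dsum2 X Y => z.1) @ F).
  apply: cauchy_cvg; apply/cauchy_rnorm => e /Fc[A FA Ae].
  exists ((fun z : dsum2 X Y => z.1) @` A).
    by apply: (@filterS _ F _ A) => // z Az; exists z.
  move=> _ _ [z Az <-] [w Aw <-]; apply: le_trans (Ae _ _ Az Aw).
  by rewrite rnorm_dsum2 ler_hypotl ?rnorm_ge0.
have cvg2 : cvg ((fun z : dsum2 X Y => z.2) @ F).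
  apply: cauchy_cvg; apply/cauchy_rnorm => e /Fc[A FA Ae].
  exists ((fun z : dsum2 X Y => z.2) @` A).
    by apply: (@filterS _ F _ A) => // z Az; exists z.
  move=> _ _ [z Az <-] [w Aw <-]; apply: le_trans (Ae _ _ Az Aw).
  by rewrite rnorm_dsum2 ler_hypotr ?rnorm_ge0.
have /cvg_ex[/= x /cvg_rnorm Fx] := cvg1.
have /cvg_ex[/= y /cvg_rnorm Fy] := cvg2.
apply/cvg_ex; exists ((x, y) : dsum2 X Y).
apply: cvg_to_rnorm => e e0.
have e20 : 0 < e / 2 by rewrite divr_gt0.
have F1 : F [set z : dsum2 X Y | rnorm (x - z.1) <= e / 2] := Fx _ e20.
have F2 : F [set z : dsum2 X Y | rnorm (y - z.2) <= e / 2] := Fy _ e20.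
apply: filterS2 F1 F2 => -[x' y'] /= xx' yy'.
rewrite rnorm_dsum2 /= (splitr e) (le_trans (hypot_ler_norm _ _))//.
by rewrite !ger0_norm ?rnorm_ge0// lerD.
Qed.

HB.instance Definition _ :=
  Uniform_isComplete.Build (dsum2 X Y) dsum2_complete.

End DirectSum2Complete.

Section Ell2.
Variables (R : realType) (k : scalar_kind).
Local Notation K := (scalars R k).
Implicit Types x y : nat -> K^o.

Definition square_summable : {pred nat -> K^o} :=
  fun x => `[< cvgn (series (fun n => rnorm (x n) ^+ 2)) >].

Definition partial_norm x (n : nat) : R :=
  Num.sqrt (series (fun n => rnorm (x n) ^+ 2) n).

Lemma partial_norm0 x : partial_norm x 0 = 0.
Proof. by rewrite /partial_norm /series /= big_geq// sqrtr0. Qed.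

Lemma series_sqr_ge0 x n : 0 <= series (fun n => rnorm (x n) ^+ 2) n.
Proof. by apply: sumr_ge0 => i _; exact: sqr_ge0. Qed.

Lemma partial_normS x n :
  partial_norm x n.+1 = hypot (partial_norm x n) (rnorm (x n)).
Proof.
rewrite /partial_norm /hypot sqr_sqrtr ?series_sqr_ge0//.
by rewrite /series /= big_nat_recr.
Qed.

Lemma partial_norm_ge0 x n : 0 <= partial_norm x n.
Proof. exact: sqrtr_ge0. Qed.

Lemma partial_normD x y n :
  partial_norm (x + y) n <= partial_norm x n + partial_norm y n.
Proof.
elim: n => [|n IH]; first by rewrite !partial_norm0 addr0.
rewrite !partial_normS; apply: le_trans (hypotD _ _ _ _).
by rewrite ler_hypot ?partial_norm_ge0 ?rnorm_ge0 ?rnormD.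
Qed.

Lemma partial_normZ a x n :
  partial_norm (a *: x) n = real_part `|a| * partial_norm x n.
Proof.
elim: n => [|n IH]; first by rewrite !partial_norm0 mulr0.
rewrite !partial_normS IH -hypotM; first by rewrite rnormZ.
exact: (rnorm_ge0 (a : K^o)).
Qed.

Lemma nondecreasing_series_sqr x :
  nondecreasing_seq (series (fun n => rnorm (x n) ^+ 2)).
Proof. by apply: nondecreasing_series => n _ _; exact: sqr_ge0. Qed.

Lemma square_summableP x :
  reflect (exists M, forall n, partial_norm x n <= M) (x \in square_summable).
Proof.
apply: (iffP (asboolP _)) => [xc|[M xM]].
  exists (Num.sqrt (limn (series (fun n => rnorm (x n) ^+ 2)))) => n.
  apply: ler_wsqrtr; apply: nondecreasing_cvgn_le => //.
  exact: nondecreasing_series_sqr.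
apply: nondecreasing_is_cvgn; first exact: nondecreasing_series_sqr.
exists (M ^+ 2) => _ [n _ <-].
rewrite -[leLHS]sqr_sqrtr ?series_sqr_ge0// ler_sqr ?nnegrE ?sqrtr_ge0//.
  exact: xM.
exact: le_trans (partial_norm_ge0 x 0) (xM 0%N).
Qed.

Lemma square_summable_closed : GRing.subsemimod_closed square_summable.
Proof.
split; first split.
- apply/square_summableP; exists 0; elim=> [|n IH].
    by rewrite partial_norm0.
  rewrite partial_normS rnorm0 (le_trans (hypot_ler_norm _ _))//.
  by rewrite normr0 addr0 ger0_norm ?partial_norm_ge0.
- move=> x y /square_summableP[M xM] /square_summableP[N yN].
  apply/square_summableP; exists (M + N) => n.
  exact: le_trans (partial_normD _ _ _) (lerD (xM n) (yN n)).
- move=> a x /square_summableP[M xM]; apply/square_summableP.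
  exists (real_part `|a| * M) => n.
  by rewrite partial_normZ ler_wpM2l// (rnorm_ge0 (a : K^o)).
Qed.

Record ell2 :=
  Ell2 { ell2_val :> nat -> K^o; ell2P : ell2_val \in square_summable }.

HB.instance Definition _ := [isSub for ell2_val].
HB.instance Definition _ := [Choice of ell2 by <:].
HB.instance Definition _ := GRing.SubChoice_isSubLmodule.Build _ _ _ ell2
  square_summable_closed.

Definition ell2_norm (x : ell2) : K :=
  of_real k (Num.sqrt (limn (series (fun n => rnorm (x n) ^+ 2)))).

Lemma partial_norm_le_ell2 (x : ell2) n :
  partial_norm x n <= real_part (ell2_norm x).
Proof.
have /asboolP xc := ell2P x.
rewrite of_realK; apply: ler_wsqrtr; apply: nondecreasing_cvgn_le => //.
exact: nondecreasing_series_sqr.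
Qed.

Lemma ell2_norm_le (x : ell2) M :
  (forall n, partial_norm x n <= M) -> real_part (ell2_norm x) <= M.
Proof.
move=> xM; have /asboolP xc := ell2P x.
have M0 : 0 <= M by exact: le_trans (partial_norm_ge0 x 0) (xM 0%N).
rewrite of_realK -[leRHS]ger0_norm// -sqrtr_sqr; apply: ler_wsqrtr.
apply: limr_le => //; apply: filterE => n.
rewrite -[leLHS]sqr_sqrtr ?series_sqr_ge0// ler_sqr ?nnegrE ?sqrtr_ge0//.
exact: xM.
Qed.

Lemma ell2_normK (x : ell2) : of_real k (real_part (ell2_norm x)) = ell2_norm x.
Proof. by rewrite of_realK. Qed.

Lemma ell2_normD (x y : ell2) : ell2_norm (x + y) <= ell2_norm x + ell2_norm y.
Proof.
rewrite -(ell2_normK x) -(ell2_normK y) -(ell2_normK (x + y)) -of_realD.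
rewrite ler_of_real; apply: ell2_norm_le => n.
apply: le_trans (partial_normD _ _ _) _.
by rewrite lerD ?partial_norm_le_ell2.
Qed.

Lemma ell2_norm_ge0 (x : ell2) : 0 <= real_part (ell2_norm x).
Proof. exact: le_trans (partial_norm_ge0 x 0) (partial_norm_le_ell2 x 0). Qed.

Lemma ell2_normZ_le a (x : ell2) :
  real_part (ell2_norm (a *: x)) <= real_part `|a| * real_part (ell2_norm x).
Proof.
apply: ell2_norm_le => n; rewrite partial_normZ.
by rewrite ler_wpM2l ?partial_norm_le_ell2// (rnorm_ge0 (a : K^o)).
Qed.

Lemma ell2_normZ a (x : ell2) : ell2_norm (a *: x) = `|a| * ell2_norm x.
Proof.
rewrite -(ell2_normK x) -(ell2_normK (a *: x)) -[`|a|]of_real_ge0// -of_realM.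
congr of_real; apply/le_anti; rewrite ell2_normZ_le /=.
have [->|a0] := eqVneq a 0.
  by rewrite normr0 -(of_real0 R k) of_realK mul0r ell2_norm_ge0.
have na0 : 0 < real_part `|a|.
  by rewrite -(ltr_of_real k) of_real_ge0 // of_real0 normr_gt0.
rewrite mulrC -ler_pdivlMr// mulrC.
have := ell2_normZ_le a^-1 (a *: x).
rewrite scalerA mulVf// scale1r (_ : real_part `|a^-1| = (real_part `|a|)^-1)//.
apply: (mulfI (lt0r_neq0 na0)); rewrite mulfV ?lt0r_neq0//.
apply: (can_inj (of_realK k)); rewrite of_realM !of_real_ge0//.
by rewrite -normrM mulfV// normr1; case: (k).
Qed.

Lemma ell2_coord_le (x : ell2) n : rnorm (x n) <= real_part (ell2_norm x).
Proof.
apply: le_trans (partial_norm_le_ell2 x n.+1).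
by rewrite partial_normS ler_hypotr ?rnorm_ge0.
Qed.

Lemma ell2_norm0_eq0 (x : ell2) : ell2_norm x = 0 -> x = 0.
Proof.
move=> x0; apply/val_inj/funext => n; apply/rnorm0_eq0/le_anti.
rewrite rnorm_ge0 andbT (le_trans (ell2_coord_le _ _))// x0.
by rewrite -(of_real0 R k) of_realK.
Qed.

HB.instance Definition _ := Lmodule_isNormed.Build K ell2
  ell2_normD ell2_normZ ell2_norm0_eq0.

Lemma ell2_complete (F : set_system ell2) : ProperFilter F -> cauchy F -> cvg F.
Proof.
move=> FF /cauchy_rnorm Fc.
have coord_cvg n : cvg ((fun x : ell2 => x n) @ F).
  apply: scalars_complete; apply/cauchy_rnorm => e /Fc[A FA Ae].
  exists ((fun x : ell2 => x n) @` A).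
    by apply: (@filterS _ F _ A) => // x Ax; exists x.
  move=> _ _ [x Ax <-] [y Ay <-]; apply: le_trans (Ae _ _ Ax Ay).
  exact: (ell2_coord_le (x - y)).
pose l : nat -> K^o := fun n => lim ((fun x : ell2 => x n) @ F).
have Fl n (d : R) : 0 < d -> F [set x : ell2 | partial_norm (l - x) n <= d].
  elim: n d => [|n IH] d d0.
    by apply: filterE => x /=; rewrite partial_norm0 ltW.
  have d20 : 0 < d / 2 by rewrite divr_gt0.
  have /cvg_rnorm ln := coord_cvg n.
  have F2 : F [set x : ell2 | rnorm (l n - x n) <= d / 2] := ln _ d20.
  apply: filterS2 (IH _ d20) F2 => x /= xn xSn.
  rewrite partial_normS (splitr d) (le_trans (hypot_ler_norm _ _))//.
  by rewrite !ger0_norm ?partial_norm_ge0 ?rnorm_ge0// lerD.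
have lA (e : R) : 0 < e ->
    exists2 A, F A & forall (x : ell2), A x -> forall n, partial_norm (l - x) n <= e.
  move=> /Fc[A FA Ae]; exists A => // x Ax n; apply/ler_addgt0Pr => d d0.
  have [y [Ay ly]] := filter_ex (filterI FA (Fl n d d0)).
  have -> : l - (x : nat -> K^o) = ell2_val (y - x) + (l - (y : nat -> K^o)).
    by rewrite [RHS]addrC -[ell2_val (y - x)]/(ell2_val y - ell2_val x) addrA subrK.
  rewrite (le_trans (partial_normD _ _ _))// lerD//.
  exact: le_trans (partial_norm_le_ell2 (y - x) n) (Ae _ _ Ay Ax).
have lsum : l \in square_summable.
  have [A FA Al] := lA _ ltr01; have [x Ax] := filter_ex FA.
  apply/square_summableP; exists (1 + real_part (ell2_norm x)) => n.
  rewrite -[l](subrK (x : nat -> K^o)) (le_trans (partial_normD _ _ _))//.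
  by rewrite lerD ?partial_norm_le_ell2 ?Al.
apply/cvg_ex; exists (Ell2 lsum); apply: cvg_to_rnorm => e /lA[A FA Al].
by apply: filterS FA => x /Al lx; exact: (@ell2_norm_le (Ell2 lsum - x)).
Qed.

HB.instance Definition _ := Uniform_isComplete.Build ell2 ell2_complete.

End Ell2.

Section BanachSpaces.
Variables (R : realType) (k : scalar_kind).
Local Notation K := (scalars R k).

Definition linearly_isometric (X Y : normedModType K) : Prop :=
  exists f : {linear X -> Y},
    (forall x, `|f x| = `|x|) /\ (forall y, exists x, f x = y).

Definition finite_dimensional (V : normedModType K) : Prop :=
  exists (n : nat) (e : 'I_n -> V),
    forall v, exists c : 'I_n -> K, v = \sum_(i < n) c i *: e i.

Definition hilbert_space (H : completeNormedModType K) : Prop :=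
  exists dot : {dot H for @conjugate R k}, forall x, dot x x = `|x| ^+ 2.

Definition elementarily_equivalent (X Y : completeNormedModType K) : Prop :=
  exists (I : Type) (U : set_system I) (UU : UltraFilter U)
         (J : Type) (V : set_system J) (VV : UltraFilter V),
    linearly_isometric (ultrapower UU X) (ultrapower VV Y).

Definition elementary_class (X Y : completeNormedModType K) : Prop :=
  elementarily_equivalent Y X.

(* Cardinals are represented by types: [kappa] stands for its cardinality. *)
Definition has_density_character (X : normedModType K) (kappa : Type) : Prop :=
  (exists2 D : set X, dense D & D #= [set: kappa]) /\
  (forall D : set X, dense D -> [set: kappa] #<= D).

Definition categorical (kappa : Type) (X : completeNormedModType K) : Prop :=
  exists Y : completeNormedModType K,
    [/\ elementary_class X Y, has_density_character Y kappa &
        forall Z : completeNormedModType K,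
          elementary_class X Z -> has_density_character Z kappa ->
          linearly_isometric Z Y].

Definition totally_categorical (X : completeNormedModType K) : Prop :=
  forall kappa : Type, infinite_set [set: kappa] -> categorical kappa X.

End BanachSpaces.

(* Main.v *)
Require Import Defs.
From HB Require Import structures.
From mathcomp Require Import all_boot all_order all_algebra.
From mathcomp Require Import all_classical reals topology normedtype.
From mathcomp Require Import complex ring lra.
From mathcomp Require Import sequences.

(** Let q be the squared norm of a Banach space X and call h Hilbertian if
    q (y + h) + q (y - h) = 2 (q y + q h) for every y.  The Hilbertian vectors
    form a closed subspace N(X), a Hilbert space, and X = M(X) (+)_2 N(X) by the
    usual nearest point argument; M(X) has no nonzero Hilbertian vector.
    Since a vector of X that is Hilbertian in an ultrapower X_U is Hilbertian in
    X, an isometry X_U = (E (+)_2 l2)_V = E (+)_2 H' embeds M(X) linearly in E,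
    so M(X) is finite dimensional and X_U = M(X) (+)_2 N(X)_U.  An isometry
    preserves the Hilbertian vectors and their orthogonal, hence M(X) = M(E),
    and N(E) is absorbed by N(X): X = M(E) (+)_2 N(X) = E (+)_2 N(X).
    Conversely, for a regular ultrafilter on the finite lists over a large set
    A, the ultrapowers of H and of l2 are Hilbert spaces of dimension 2 ^ |A|.
    Categoricity follows because E (+)_2 H has density character |T| when H has
    an infinite orthonormal basis indexed by T. *)

Set Implicit Arguments.
Unset Strict Implicit.
Unset Printing Implicit Defensive.
Import Order.TTheory GRing.Theory Num.Theory.
Import numFieldNormedType.Exports.
Local Open Scope classical_set_scope.
Local Open Scope card_scope.

(** * Cardinal arithmetic *)

(** The obstacle is that only the vector h is tame: [hvec h] constrains the norm near [h] alone,
    while [y] ranges over an arbitrary Banach space, so closure of the Hilbertian vectors under sums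
    is not formal. The form [rform y h] is additive in [h] by the parallelogram law; additivity in
    [y] comes instead from convexity of the squared norm, and everything about N(X) rests on it.
    Since N(X) is defined by the norm alone, every isometry respects it, whatever summands were used
    to write the spaces down. Finite dimension matters because bounded families in such a space
    converge along ultrafilters: the space equals its ultrapower and can be pulled out of the
    ultrapower of a direct sum. In the converse, one ultrafilter must serve both Hilbert spaces, and
    the two estimates of the dimension must meet: subsets of A give the lower one, counting all
    points of the ultrapower the upper one, and they agree because A is at least as large as the
    spaces themselves. Hence the need for |A x A| = |A| and its consequences, stated for types and
    injections because index sets of bases are types. *)

Definition embeds (A B : Type) : Prop := exists f : A -> B, injective f.

Lemma embeds_refl A : embeds A A. Proof. by exists id. Qed.

Lemma embeds_trans B A C : embeds A B -> embeds B C -> embeds A C.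
Proof. by move=> [f fI] [g gI]; exists (g \o f); exact: inj_comp. Qed.

Lemma embeds_prod A B A' B' : embeds A A' -> embeds B B' ->
  embeds (A * B) (A' * B').
Proof.
move=> [f fI] [g gI]; exists (fun p => (f p.1, g p.2)).
by move=> [a b] [c d] /= [/fI -> /gI ->].
Qed.

Lemma embeds_sum A B A' B' : embeds A A' -> embeds B B' ->
  embeds (A + B) (A' + B').
Proof.
move=> [f fI] [g gI]; exists (fun p => match p with inl a => inl (f a)
  | inr b => inr (g b) end).
by move=> [a|a] [b|b] //= [] => [/fI|/gI] ->.
Qed.

Lemma embeds_setP T U (A : set T) (B : set U) :
  reflect (embeds A B) (A #<= B).
Proof.
apply: (iffP card_leP) => [[f]|[f fI]].
  by exists f => x y; apply: (inj (f := f)); rewrite inE.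
by apply/injfunPex; exists f => // x y _ _; exact: fI.
Qed.

Lemma embeds_setT T : embeds T [set: T] /\ embeds [set: T] T.
Proof.
split; last by exists val; exact: val_inj.
by exists (fun x => SigSub (mem_set (I : [set: T] x))) => x y [].
Qed.

Lemma embedsP T U : reflect (embeds T U) ([set: T] #<= [set: U]).
Proof.
have [T1 T2] := embeds_setT T; have [U1 U2] := embeds_setT U.
apply: (iffP (embeds_setP _ _)) => TU.
  exact: embeds_trans T1 (embeds_trans TU U2).
exact: embeds_trans T2 (embeds_trans TU U1).
Qed.

(** Cantor-Bernstein, transported from full sets to types. *)
Lemma embeds_bij T U : embeds T U -> embeds U T ->
  exists2 f : T -> U, injective f & forall y, exists x, f x = y.
Proof.
move=> /embedsP TU /embedsP UT.
have /card_bijP[f fb] : [set: T] #= [set: U] by apply/card_eqPle.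
pose t (x : T) : [set: T] := SigSub (mem_set (I : [set: T] x)).
have valt (x : [set: T]) : t (val x) = x by exact: val_inj.
exists (fun x => val (f (t x))).
  by move=> x y /val_inj /(bij_inj fb) [].
move=> y; have [g _ fg] := fb.
by exists (val (g (SigSub (mem_set (I : [set: U] y))))); rewrite valt fg.
Qed.

(** Zorn's lemma for the sets whose union with [A0] satisfies [P]; the empty chain is covered by
    [P A0], so chains can be taken nonempty. *)
Lemma Zorn_above (T : Type) (P : set (set T)) (A0 : set T) : P A0 ->
    (forall F : set (set T), F !=set0 -> F `<=` P -> total_on F subset ->
      P (\bigcup_(X in F) X)) ->
  exists A, [/\ P A, A0 `<=` A & forall B, A `<=` B -> P B -> B = A].
Proof.
move=> PA0 Pch.
have [|A [PA Amax]] := @Zorn_bigcup T (fun A => P (A0 `|` A)).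
  move=> F FP totF; have [->|/set0P F0] := eqVneq F set0.
    by rewrite bigcup_set0 setU0.
  have -> : A0 `|` \bigcup_(X in F) X =
      \bigcup_(X in [set A0 `|` Y | Y in F]) X.
    rewrite bigcup_image; apply/seteqP; split=> [x [A0x|[X FX Xx]]|x [X FX]].
    - by have [X FX] := F0; exists X => //; left.
    - by exists X => //; right.
    - by move=> [A0x|Xx]; [left|right; exists X].
  apply: Pch.
  - by have [X FX] := F0; exists (A0 `|` X), X.
  - by move=> _ [X FX <-]; exact: FP.
  - move=> _ _ [X FX <-] [Y FY <-].
    by have [XY|YX] := totF X Y FX FY; [left|right]; apply: setUS.
exists (A0 `|` A); split=> //.
move=> B A0AB PB; apply/seteqP; split=> //.
have A0B : A0 `<=` B by exact: subset_trans A0AB; left.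
have AB : A `<=` B by apply: subset_trans A0AB; right.
have [BA|nBA] := pselect (B `<=` A); first by move=> x /BA; right.
by exfalso; apply: (Amax B) => //; rewrite (setUidr A0B).
Qed.

Lemma embeds_total A B : embeds A B \/ embeds B A.
Proof.
pose P (G : set (A * B)) :=
  (forall a b b', G (a, b) -> G (a, b') -> b = b') /\
  (forall a a' b, G (a, b) -> G (a', b) -> a = a').
have [||G [[Gf Gi] _ Gmax]] := @Zorn_above _ P set0.
- by split.
- move=> F F0 FP totF; have both p q : (\bigcup_(X in F) X) p ->
      (\bigcup_(X in F) X) q -> exists2 X, F X & X p /\ X q.
    move=> [X FX Xp] [Y FY Yq]; have [XY|YX] := totF _ _ FX FY.
      by exists Y => //; split=> //; exact: XY.
    by exists X => //; split=> //; exact: YX.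
  by split=> [a b b'|a a' b] p q; have [X /FP[Xf Xi] [Xp Xq]] := both _ _ p q;
    [exact: Xf Xp Xq|exact: Xi Xp Xq].
have [domG|/existsNP[a aG]] := pselect (forall a, exists b, G (a, b)).
  by left; have [f fG] := choice domG; exists f => a a' ff;
    apply: Gi (fG a) _; rewrite ff; exact: fG.
have [ranG|/existsNP[b bG]] := pselect (forall b, exists a, G (a, b)).
  by right; have [f fG] := choice ranG; exists f => b b' ff;
    apply: Gf (fG b) _; rewrite ff; exact: fG.
exfalso; apply: (aG); exists b.
rewrite -(Gmax ((a, b) |` G)); [by left|by right|split].
- move=> x y y' [[-> ->]|xy] [[]|xy'].
  + by move=> ->.
  + by exfalso; apply: (aG); exists y'.
  + by move=> xa _; exfalso; apply: (aG); exists y; rewrite -xa.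
  + exact: Gf xy xy'.
- move=> x x' y [[-> ->]|xy] [[]|xy'].
  + by move=> ->.
  + by exfalso; apply: (bG); exists x'.
  + by move=> _ yb; exfalso; apply: (bG); exists x; rewrite -yb.
  + exact: Gi xy xy'.
Qed.

Lemma infinite_embeds_nat T : infinite_set [set: T] <-> embeds nat T.
Proof. by split=> [/infiniteP/embedsP|/embedsP/infiniteP]. Qed.

(* Zorn's lemma is applied to the graphs of injections S * S -> S, S a subset
   of T; if S is maximal but smaller than T then T \ S contains a copy S' of S
   and the injection extends to S `|` S'. *)
Lemma embeds_square T : embeds nat T -> embeds (T * T) T.
Proof.
move=> [e eI].
(* The base set of a graph is read off the diagonal of its domain, so the graph alone is the object
   to which Zorn's lemma applies. *)
pose S (G : set (T * T * T)) x := exists z, G (x, x, z).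
pose P (G : set (T * T * T)) :=
  [/\ forall p z z', G (p, z) -> G (p, z') -> z = z',
      forall p p' z, G (p, z) -> G (p', z) -> p = p',
      forall x y, S G x -> S G y -> exists z, G (x, y, z) &
      forall x y z, G (x, y, z) -> [/\ S G x, S G y & S G z]].
have [c cI] : embeds (nat * nat) nat.
  by exists pickle; exact: pcan_inj pickleK.
(* Starting from a copy of a pairing of the natural numbers keeps the base nonempty, with two
   distinct points for [boolA]. *)
pose G0 := [set (e p.1, e p.2, e (c p)) | p in [set: nat * nat]].
have SG0 n : S G0 (e n) by exists (e (c (n, n))), (n, n).
have [||G [[Gf Gi Gt Gr] G0G Gmax]] := @Zorn_above _ P G0.
- split.
  + by move=> p z z' [[a b] _ [<- <-]] [[m n] _ [/eI -> /eI -> <-]].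
  + by move=> p p' z [[a b] _ [<- <-]] [[m n] _ [<- /eI/cI[-> ->]]].
  + move=> x y [z [[a b] _ [<- _ _]]] [z' [[a' b'] _ [<- _ _]]].
    by exists (e (c (a, a'))), (a, a').
  + by move=> x y z [[a b] _ [<- <- <-]].
- move=> F F0 FP totF.
  pose U := \bigcup_(X in F) X.
  have both p q : U p -> U q -> exists2 X, F X & X p /\ X q.
    move=> [X FX Xp] [Y FY Yq]; have [XY|YX] := totF _ _ FX FY.
      by exists Y => //; split=> //; exact: XY.
    by exists X => //; split=> //; exact: YX.
  split.
  + by move=> p z z' a b; have [X /FP[Xf _ _ _] [Xp Xq]] := both _ _ a b;
      exact: Xf Xp Xq.
  + by move=> p z z' a b; have [X /FP[_ Xi _ _] [Xp Xq]] := both _ _ a b;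
      exact: Xi Xp Xq.
  + move=> x y [z xz] [z' yz']; have [X FX [Xp Xq]] := both _ _ xz yz'.
    have [_ _ Xt _] := FP _ FX.
    have [||t Xt'] := Xt x y; [by exists z|by exists z'|].
    by exists t, X.
  + move=> x y z [X FX Xxyz]; have [_ _ _ Xr] := FP _ FX.
    have [[a Xa] [b Xb] [d Xd]] := Xr _ _ _ Xxyz.
    by split; [exists a|exists b|exists d]; exists X.
pose A := {x | S G x}; pose C := {x | ~ S G x}.
have valA : embeds A T by exists sval => a b; exact: eq_sig_hprop.
have [f fI] : embeds (A * A) A.
  have fex (p : A * A) : exists z, G (sval p.1, sval p.2, sval (z : A)).
    case: p => -[x Sx] [y Sy] /=; have [z xyz] := Gt x y Sx Sy.
    by have [_ _ Sz] := Gr _ _ _ xyz; exists (exist _ z Sz).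
  have [f fG] := choice fex; exists f => -[a b] [a' b'] fE.
  have := fG (a, b); rewrite fE => /Gi /(_ (fG (a', b'))) /= [aa bb].
  by congr pair; exact: eq_sig_hprop.
have SGe n : S G (e n) by have [z zG] := SG0 n; exists z; exact: G0G.
have boolA : embeds (bool * A) A.
  apply: (@embeds_trans (A * A)); last by exists f.
  apply: embeds_prod (embeds_refl _).
  exists (fun b : bool => if b then exist _ _ (SGe 0%N) else exist _ _ (SGe 1%N)).
  by move=> [] [] //= [] /eI.
have sumA : embeds (A + A) A.
  apply: embeds_trans boolA.
  exists (fun s : A + A => match s with inl a => (true, a) | inr a => (false, a) end).
  by move=> [a|a] [b|b] [] // ->.
have [CA|[g gI]] := embeds_total C A.
  have TA : embeds T A.
    apply: (@embeds_trans (A + A)) sumA.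
    apply: (@embeds_trans (A + C)); last exact: embeds_sum (embeds_refl _) CA.
    exists (fun x => match pselect (S G x) with
      | left h => inl (exist _ x h) | right h => inr (exist _ x h) end).
    by move=> x y; case: pselect => ?; case: pselect => ? [].
  apply: (embeds_trans (embeds_prod TA TA)).
  by apply: embeds_trans valA; exists f.
exfalso.
(* [false] marks the old base and [true] its copy in the complement. *)
pose i (p : bool * A) := if p.1 then sval (g p.2) else sval p.2.
have iI : injective i.
  move=> [[] [x Sx]] [[] [y Sy]] /=; rewrite /i /=.
  - by move=> h; congr pair; apply: gI; exact: eq_sig_hprop.
  - by move=> h; exfalso; case: (g _) h => z /= nSz zy; apply: nSz; rewrite zy.
  - by move=> h; exfalso; case: (g _) h => z /= nSz zy; apply: nSz; rewrite -zy.
  - by move=> h; congr pair; exact: eq_sig_hprop.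
have [h hI] : embeds ((bool * A) * (bool * A)) A.
  apply: embeds_trans (embeds_prod boolA boolA) _.
  by exists f.
have niS a : ~ S G (i (true, a)) by rewrite /i /=; case: (g a).
have iS a : S G (i (false, a)) by case: a.
(* Only pairs with a coordinate in the new copy receive a value, and it lies in the new copy: the
   extension meets [G] neither in its arguments nor in its values. *)
pose D := [set (i p.1, i p.2, i (true, h p)) |
  p in [set p : (bool * A) * (bool * A) | p.1.1 || p.2.1]].
have ni1 (b : bool * A) : b.1 -> ~ S G (i b) by case: b => -[] // a _; exact: niS.
have SU x : S (G `|` D) x <-> exists b, x = i b.
  split=> [[z [xz|[[[b1 a1] [b2 a2]] /= b12 []]]]|].
  - have Sx : S G x by exists z.
    by exists (false, exist _ x Sx).
  - by move=> <- _ _; exists (b1, a1).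
  move=> [[[] a] ->]; last by have [z] := iS a; exists z; left.
  by exists (i (true, h ((true, a), (true, a)))); right; exists ((true, a), (true, a)).
have GD x y z z' : G (x, y, z) -> D (x, y, z') -> False.
  by move=> /Gr[Sx Sy _] [[b1 b2] /= /orP[] /ni1 nS [E1 E2 _]]; apply: nS;
    rewrite ?E1 ?E2.
suff PGD : P (G `|` D).
  have GDE := Gmax _ (@subsetUl _ G D) PGD.
  pose a0 : A := exist _ _ (SGe 0%N).
  apply: (niS a0); rewrite -GDE; apply/SU; by exists (true, a0).
split.
- move=> [x y] z z' [Gz|Dz] [Gz'|Dz'].
  + exact: Gf Gz Gz'.
  + by case: (GD _ _ _ _ Gz Dz').
  + by case: (GD _ _ _ _ Gz' Dz).
  + case: Dz Dz' => -[b1 b2] /= _ [<- <- <-].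
    by move=> [[b1' b2'] /= _ [/iI -> /iI -> <-]].
- move=> [x y] [x' y'] z [Gz|Dz] [Gz'|Dz'].
  + exact: Gi Gz Gz'.
  + case: Dz' => p _ [_ _ zE]; case: (Gr _ _ _ Gz) => _ _; rewrite -zE.
    by move/niS.
  + case: Dz => p _ [_ _ zE]; case: (Gr _ _ _ Gz') => _ _; rewrite -zE.
    by move/niS.
  + case: Dz Dz' => -[b1 b2] /= _ [<- <- <-].
    by move=> [[b1' b2'] /= _ [<- <- /iI[/hI[-> ->]]]].
- move=> x y /SU[b ->] /SU[b' ->].
  have [bb|] := boolP (b.1 || b'.1).
    by exists (i (true, h (b, b'))); right; exists (b, b').
  case: b b' => -[] a [[] a'] // _.
  by have [z Gz] := Gt _ _ (iS a) (iS a'); exists z; left.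
- move=> x y z [Gz|[[b b'] _ /= [<- <- <-]]].
    have [[a Sa] [b Sb] [d Sd]] := Gr _ _ _ Gz.
    by split; [exists a|exists b|exists d]; left.
  by split; apply/SU; [exists b|exists b'|exists (true, h (b, b'))].
Qed.

Lemma embeds_seq T : embeds nat T -> embeds (seq T) T.
Proof.
move=> natT; have [c cI] := embeds_square natT; have [e eI] := natT.
pose fix enc (s : seq T) : T :=
  if s is x :: s' then c (x, enc s') else e 0%N.
(* The length is coded too, because the code [e 0%N] of the empty list may also be a value of
   [c]. *)
exists (fun s => c (e (size s), enc s)) => s t /cI[/eI].
elim: s t => [|x s IH] [|y t] //= [st] /cI[-> /IH -> //].
Qed.

Lemma embeds_nat_sum T : embeds nat T -> embeds (nat + T) T.
Proof.
move=> natT; apply: (embeds_trans _ (embeds_square natT)).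
have [e eI] := natT.
exists (fun s => match s with inl n => (e 0%N, e n) | inr x => (e 1%N, x) end).
by move=> [n|x] [m|y] [] => [/eI ->|/eI|/eI|->].
Qed.

Local Open Scope ring_scope.
Local Open Scope quotient_scope.

(** * Hilbertian vectors *)

Section Scalars.
Variables (R : realType) (k : scalar_kind).
Local Notation K := (scalars R k).

Definition abs (a : K) : R := real_part `|a|.

Lemma absE (a : K) : of_real k (abs a) = `|a|.
Proof. exact: of_real_ge0. Qed.

Lemma of_realN (t : R) : of_real k (- t) = - of_real k t.
Proof. by case: k => //=; exact: rmorphN. Qed.

Lemma of_real1 : of_real k (1 : R) = 1. Proof. by case: k. Qed.

Lemma abs_ge0 (a : K) : 0 <= abs a.
Proof. exact: (rnorm_ge0 (a : K^o)). Qed.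

Lemma abs_of_real (t : R) : abs (of_real k t) = `|t|.
Proof.
apply: (can_inj (of_realK k)); rewrite absE.
have [t0|/ltW t0] := leP 0 t.
  by rewrite !ger0_norm // -(of_real0 R k) ler_of_real.
by rewrite !ler0_norm ?of_realN // -(of_real0 R k) ler_of_real.
Qed.

Lemma abs1 : abs (1 : K) = 1.
Proof. by rewrite -of_real1 abs_of_real normr1. Qed.

End Scalars.

(** Archimedean substitute for a limit: the left side is scaled by [n] while the error stays
    bounded. *)
Lemma natr_bound_le0 (R : realType) (x C : R) :
  (forall n : nat, x *+ n <= C) -> x <= 0.
Proof.
move=> xC; rewrite leNgt; apply/negP => x0.
have := archi_boundP (normr_ge0 (C / x)).
set m := Num.bound _ => Cm.
have := xC m; rewrite leNgt => /negP; apply.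
rewrite -mulr_natr -ltr_pdivrMl // mulrC.
exact: le_lt_trans (ler_norm _) Cm.
Qed.

Section HilbertVectors.
Variables (R : realType) (k : scalar_kind) (X : normedModType (scalars R k)).
Local Notation K := (scalars R k).
Implicit Types (x y z h g : X).

Definition sqn x : R := rnorm x ^+ 2.

(* The vectors of the largest Hilbertian l2-summand of X. *)
Definition hvec h : Prop := forall y, sqn (y + h) + sqn (y - h) = 2 * (sqn y + sqn h).

(* The real part of the inner product of y with a Hilbertian vector h. *)
Definition rform y h : R := (sqn (y + h) - sqn (y - h)) / 4.

Lemma sqn_ge0 x : 0 <= sqn x. Proof. exact: sqr_ge0. Qed.

Lemma sqn0 : sqn 0 = 0. Proof. by rewrite /sqn rnorm0 expr0n. Qed.

Lemma sqn_eq0 x : sqn x = 0 -> x = 0.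
Proof. by move/eqP; rewrite expf_eq0 => /eqP/rnorm0_eq0. Qed.

Lemma sqnN x : sqn (- x) = sqn x. Proof. by rewrite /sqn rnormN. Qed.

Lemma sqnB x y : sqn (x - y) = sqn (y - x). Proof. by rewrite /sqn rnormB. Qed.

Lemma sqnZ (a : K) x : sqn (a *: x) = abs a ^+ 2 * sqn x.
Proof. by rewrite /sqn rnormZ exprMn. Qed.

Lemma sqnMn x n : sqn (x *+ n) = n%:R * (n%:R * sqn x).
Proof.
have -> : x *+ n = of_real k n%:R *: x.
  rewrite -scaler_nat; congr (_ *: _).
  elim: n => [|n IH]; first by rewrite mulr0n of_real0.
  by rewrite !mulrS of_realD -IH of_real1.
by rewrite sqnZ abs_of_real ger0_norm ?ler0n // expr2 mulrA.
Qed.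

(** Midpoint convexity of [sqn]; it stands in for the parallelogram law where no vector is known to
    be Hilbertian. *)
Lemma sqn_midpoint x y : sqn (x + y) <= 2 * (sqn x + sqn y).
Proof.
have := rnormD x y; have := rnorm_ge0 x; have := rnorm_ge0 y.
rewrite /sqn; have := rnorm_ge0 (x + y).
set a := rnorm x; set b := rnorm y; set c := rnorm (x + y) => c0 b0 a0 cab.
apply: (@le_trans _ _ ((a + b) ^+ 2)); first by rewrite ler_sqr ?nnegrE ?addr_ge0.
have := sqr_ge0 (a - b); nra.
Qed.

Lemma hvec0 : hvec 0. Proof. by move=> y; rewrite subr0 addr0 sqn0; ring. Qed.

Lemma hvecN h : hvec h -> hvec (- h).
Proof. by move=> hh y; rewrite opprK addrC hh sqnN. Qed.

Lemma hvecZ (a : K) h : hvec h -> hvec (a *: h).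
Proof.
move=> hh y; have [->|a0] := eqVneq a 0; first by rewrite scale0r; exact: hvec0.
have -> : y = a *: (a^-1 *: y) by rewrite scalerA mulfV // scale1r.
move: (a^-1 *: y) => z.
by rewrite -scalerDr -scalerBr !sqnZ -mulrDr hh; ring.
Qed.

Lemma hvecMn h n : hvec h -> hvec (h *+ n).
Proof. by move=> hh; rewrite -scaler_nat; exact: hvecZ. Qed.

Lemma sqn_rformD y h : hvec h -> sqn (y + h) = sqn y + sqn h + 2 * rform y h.
Proof. by move=> /(_ y) hh; rewrite /rform; lra. Qed.

Lemma rformNr y h : rform y (- h) = - rform y h.
Proof. by rewrite /rform opprK; lra. Qed.

Lemma rformNl y h : rform (- y) h = - rform y h.
Proof.
by rewrite /rform -[sqn (- y + h)]sqnN -[sqn (- y - h)]sqnN !opprD !opprK; lra.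
Qed.

Lemma rformC y h : rform y h = rform h y.
Proof. by rewrite /rform (addrC y) (sqnB y). Qed.

Lemma rform0r y : rform y 0 = 0.
Proof. by rewrite /rform subr0 addr0 subrr mul0r. Qed.

Lemma rform0l y : rform 0 y = 0. Proof. by rewrite rformC rform0r. Qed.

Lemma rform_diag x : rform x x = sqn x.
Proof. by rewrite /rform subrr sqn0 subr0 -mulr2n sqnMn; field. Qed.

Lemma rformZ (a : K) y h : rform (a *: y) (a *: h) = abs a ^+ 2 * rform y h.
Proof. by rewrite /rform -scalerDr -scalerBr !sqnZ -mulrBr mulrA. Qed.

(** The parallelogram law suffices here: subtracting it at [y - u] from it at [y + u] gives
    [double], and adding [double] to itself with the roles of [h] and [g] exchanged gives the
    claim. *)
Lemma rformDr y h g : hvec h -> hvec g -> rform y (h + g) = rform y h + rform y g.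
Proof.
move=> hh hg.
suff double u v : hvec u -> hvec v ->
    rform y (u + v) + rform y (u - v) = 2 * rform y u.
  have := double _ _ hh hg; have := double _ _ hg hh.
  by rewrite (addrC g) -[g - h]opprB rformNr; lra.
move=> hu hv.
have := hv (y + u); have := hv (y - u); rewrite /rform.
by rewrite !opprD !opprK !addrA => ? ?; lra.
Qed.

Lemma rformMnr y h n : hvec h -> rform y (h *+ n) = rform y h *+ n.
Proof.
move=> hh; elim: n => [|n IH]; first by rewrite rform0r.
by rewrite !mulrS rformDr ?IH //; exact: hvecMn.
Qed.

(** Cauchy-Schwarz read off the triangle inequality, by expanding the square of [rnorm (y + h)]. *)
Lemma rform_le y h : hvec h -> rform y h <= rnorm y * rnorm h.
Proof.
move=> /(sqn_rformD y); rewrite /sqn; have := rnormD y h.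
have := rnorm_ge0 y; have := rnorm_ge0 h; have := rnorm_ge0 (y + h).
set a := rnorm y; set b := rnorm h; set c := rnorm (y + h) => c0 b0 a0 cab.
have : c ^+ 2 <= (a + b) ^+ 2 by rewrite ler_sqr ?nnegrE ?addr_ge0.
nra.
Qed.

Lemma rform_norm_le y h : hvec h -> `|rform y h| <= rnorm y * rnorm h.
Proof.
move=> hh; rewrite ler_norml rform_le // andbT lerNl -rformNr.
by rewrite -(rnormN h) rform_le //; exact: hvecN.
Qed.

(* Convexity of sqn at y + n h, as n tends to infinity. *)
Lemma rformDl_le x y h : hvec h -> rform (x + y) h <= rform x h + rform y h.
Proof.
move=> hh; rewrite -subr_le0.
apply: (@natr_bound_le0 _ _ (sqn x + sqn y)) => n.
have hn : hvec (h *+ n) by exact: hvecMn.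
(* The terms in n ^ 2 agree on both sides; what remains is 4 n times the defect of additivity,
   bounded independently of n. *)
have := sqn_midpoint (x + h *+ n) (y + h *+ n).
have -> : x + h *+ n + (y + h *+ n) = (x + y) + h *+ n *+ 2.
  by rewrite addrACA mulr2n.
rewrite (sqn_rformD (x + y)); last exact: hvecMn.
rewrite (sqn_rformD x hn) (sqn_rformD y hn) !rformMnr //.
rewrite (sqnMn _ 2) -[rform (x + y) h *+ n *+ 2]mulr_natr.
have := sqn_ge0 (x + y).
rewrite mulrnBl mulrnDl => s0 mid; have := sqn_ge0 x; have := sqn_ge0 y; lra.
Qed.

(** The form is odd in its first argument, so passing to [- x] and [- y] reverses the inequality. *)
Lemma rformDl x y h : hvec h -> rform (x + y) h = rform x h + rform y h.
Proof.
move=> hh; apply/le_anti; rewrite rformDl_le //=.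
have := rformDl_le (- x) (- y) hh.
by rewrite -opprD !rformNl -opprD lerN2.
Qed.

Lemma rformBl x y h : hvec h -> rform (x - y) h = rform x h - rform y h.
Proof. by move=> hh; rewrite rformDl ?rformNl. Qed.

(** Adding [h] and then [g] to [u] produces the cross term [rform (u + h) g], which [rformDl]
    splits; the resulting expansion is used at [y] and at [- y]. *)
Lemma hvecD h g : hvec h -> hvec g -> hvec (h + g).
Proof.
move=> hh hg y.
have E u : sqn (u + (h + g)) = sqn u + sqn (h + g) + 2 * rform u (h + g).
  rewrite addrA !sqn_rformD // rformDl // rformDr //; lra.
by rewrite E -[sqn (y - _)]sqnN opprB addrC addrC [_ - y]addrC E rformNl sqnN; lra.
Qed.

(** An additive function with a Lipschitz bound at 0 is linear: writing s n as its floor plus a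
    fraction keeps n (f s - s f 1) bounded. *)
Lemma rform_real (t : R) y h : hvec h ->
  rform (of_real k t *: y) h = t * rform y h.
Proof.
move=> hh; pose f s := rform (of_real k s *: y) h.
have fD s u : f (s + u) = f s + f u by rewrite /f of_realD scalerDl rformDl.
have f0 : f 0 = 0 by rewrite /f of_real0 scale0r rform0l.
have fN s : f (- s) = - f s by rewrite /f of_realN scaleNr rformNl.
have f1 : f 1 = rform y h by rewrite /f of_real1 scale1r.
have fMn s n : f (s *+ n) = f s *+ n.
  by elim: n => [|n IH]; rewrite ?mulr0n // !mulrS fD IH.
have fle s : `|f s| <= `|s| * (rnorm y * rnorm h).
  by apply: le_trans (rform_norm_le _ hh) _; rewrite rnormZ -/(abs _) abs_of_real mulrA.
rewrite -/(f t) -f1; set C := rnorm y * rnorm h in fle.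
have C0 : 0 <= C by rewrite mulr_ge0 ?rnorm_ge0.
suff H s : f s <= s * f 1.
  apply/le_anti; rewrite H /=; have := H (- t).
  by rewrite fN mulNr lerN2.
rewrite -subr_le0; apply: (@natr_bound_le0 _ _ (C + `|f 1|)) => n.
have /andP[] := floor_itv (s *+ n); set m := Num.floor _ => ml mu.
have fz (z : int) : f z%:~R = z%:~R * f 1.
  case: z => p; first by rewrite -[_%:~R]/(p%:R : R) fMn mulr_natl.
  by rewrite NegzE mulrNz fN mulNr -[_%:~R]/(p.+1%:R : R) fMn mulr_natl.
have -> : (f s - s * f 1) *+ n = f (s *+ n - m%:~R) + (m%:~R - s *+ n) * f 1.
  by rewrite fD fN fz fMn mulrnBl mulrBl mulrnAl; ring.
apply: lerD.
  apply: le_trans (ler_norm _) (le_trans (fle _) _).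
  rewrite ler_piMl // ger0_norm ?subr_ge0 // lerBlDl.
  by rewrite ltW // -[1]/(1%:~R) -intrD.
apply: le_trans (ler_norm _) _; rewrite normrM ler_piMl ?normr_ge0 //.
rewrite distrC ger0_norm ?subr_ge0 // lerBlDl.
by rewrite ltW // -[1]/(1%:~R) -intrD.
Qed.

End HilbertVectors.

(** * Isometries, completeness and closed subspaces *)

Lemma invS_le (R : realType) (c e : R) : 0 < e ->
  exists n : nat, forall m, (n <= m)%N -> c / m.+1%:R <= e.
Proof.
move=> e0; have := archi_boundP (normr_ge0 (c / e)); set n := Num.bound _ => cn.
exists n => m nm; rewrite ler_pdivrMr ?ltr0n // mulrC -ler_pdivrMr //.
apply: (le_trans (ler_norm _)); apply: (le_trans (ltW cn)).
by rewrite ler_nat (leq_trans nm).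
Qed.

Section Isometries.
Variables (R : realType) (k : scalar_kind).
Local Notation K := (scalars R k).
Implicit Types X Y Z : normedModType K.

Lemma linearly_isometric_intro X Y (f : X -> Y) :
  (forall a x y, f (a *: x + y) = a *: f x + f y) ->
  (forall x, rnorm (f x) = rnorm x) ->
  (forall y, exists x, f x = y) -> linearly_isometric X Y.
Proof.
move=> flin fnorm fsurj.
pose L := GRing.isLinear.Build K X Y *:%R f flin.
pose g : {linear X -> Y} := HB.pack f L.
by exists g; split=> // x; rewrite -!rnormE fnorm.
Qed.

Lemma linearly_isometric_elim X Y : linearly_isometric X Y ->
  exists f : {linear X -> Y},
    (forall x, rnorm (f x) = rnorm x) /\ (forall y, exists x, f x = y).
Proof. by move=> [f [fn fs]]; exists f; split=> // x; rewrite /rnorm fn. Qed.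

Lemma isometry_inj X Y (f : {linear X -> Y}) :
  (forall x, rnorm (f x) = rnorm x) -> injective f.
Proof.
move=> fn x y fxy; apply/subr0_eq/rnorm0_eq0.
by rewrite -fn linearB fxy subrr rnorm0.
Qed.

Lemma linearly_isometric_refl X : linearly_isometric X X.
Proof. by apply: (@linearly_isometric_intro X X id) => // y; exists y. Qed.

Lemma linearly_isometric_sym X Y :
  linearly_isometric X Y -> linearly_isometric Y X.
Proof.
move=> /linearly_isometric_elim[f [fn /choice[g fg]]].
have gf x : g (f x) = x by apply: (isometry_inj fn); rewrite fg.
apply: (@linearly_isometric_intro Y X g).
- by move=> a x y; apply: (isometry_inj fn); rewrite linearP !fg.
- by move=> x; rewrite -fn fg.
- by move=> x; exists (f x).
Qed.

Lemma linearly_isometric_trans Y X Z : linearly_isometric X Y ->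
  linearly_isometric Y Z -> linearly_isometric X Z.
Proof.
move=> /linearly_isometric_elim[f [fn fs]] /linearly_isometric_elim[g [gn gs]].
apply: (@linearly_isometric_intro X Z (g \o f)).
- by move=> a x y /=; rewrite !linearP.
- by move=> x /=; rewrite gn fn.
- by move=> z; have [y <-] := gs z; have [x <-] := fs y; exists x.
Qed.

Lemma finite_dimensional_iso X Y : linearly_isometric X Y ->
  finite_dimensional X -> finite_dimensional Y.
Proof.
move=> /linearly_isometric_elim[f [fn fs]] [n [e eX]].
exists n, (f \o e) => y; have [x <-] := fs y; have [c ->] := eX x.
by exists c; rewrite linear_sum; apply: eq_bigr => i _; rewrite linearZ.
Qed.

Lemma dsum2_iso X Y X' Y' : linearly_isometric X X' ->
  linearly_isometric Y Y' -> linearly_isometric (dsum2 X Y) (dsum2 X' Y').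
Proof.
move=> /linearly_isometric_elim[f [fn fs]] /linearly_isometric_elim[g [gn gs]].
apply: (@linearly_isometric_intro _ _
  (fun z : dsum2 X Y => (f z.1, g z.2) : dsum2 X' Y')).
- by move=> a x y /=; rewrite !linearP.
- by move=> x; rewrite !rnorm_dsum2 /= fn gn.
- move=> [x y]; have [u <-] := fs x; have [v <-] := gs y.
  by exists ((u, v) : dsum2 X Y).
Qed.

Lemma dsum2A X Y Z :
  linearly_isometric (dsum2 X (dsum2 Y Z)) (dsum2 (dsum2 X Y) Z).
Proof.
apply: (@linearly_isometric_intro _ _ (fun z : dsum2 X (dsum2 Y Z) =>
  (((z.1, z.2.1) : dsum2 X Y), z.2.2) : dsum2 (dsum2 X Y) Z)).
- by [].
- by move=> z; rewrite !rnorm_dsum2 /= /hypot !sqr_hypot addrA.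
- by move=> [[x y] z]; exists ((x, ((y, z) : dsum2 Y Z)) : dsum2 X (dsum2 Y Z)).
Qed.

End Isometries.

(** * Completeness through sequences with explicit rates *)

Section Completeness.
Variables (R : realType) (k : scalar_kind).
Local Notation K := (scalars R k).

(** The limit inherits the rate, which later allows limits to be taken in each coordinate of an
    ultrapower with uniform control. *)
Lemma cauchy_seq_limit (X : completeNormedModType K) (y : nat -> X) (c : R) :
  (forall m n, (m <= n)%N -> rnorm (y m - y n) <= c / m.+1%:R) ->
  exists x, forall m, rnorm (x - y m) <= c / m.+1%:R.
Proof.
move=> yc; have /cauchy_cvg/cvg_ex[x /cvg_rnorm yx] : cauchy (y @ \oo).
  apply/cauchy_rnorm => e e0; have [N HN] := invS_le (c *+ 2) e0.
  exists [set y n | n in [set n | (N <= n)%N]].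
    by exists N => // n Nn; exists n.
  move=> _ _ [m Nm <-] [n Nn <-].
  have -> : y m - y n = (y m - y N) + (y N - y n) by rewrite addrA subrK.
  apply: le_trans (rnormD _ _) _; rewrite rnormB.
  apply: le_trans (lerD (yc _ _ Nm) (yc _ _ Nn)) _.
  by apply: le_trans (HN N _) => //; rewrite mulrnAl mulr2n.
exists x => m; apply/ler_addgt0Pl => e e0.
have [N _ HN] := yx _ e0.
have := HN (maxn N m) (leq_maxl _ _); set n := maxn N m => xn.
have -> : x - y m = (x - y n) + (y n - y m) by rewrite addrA subrK.
apply: le_trans (rnormD _ _) (lerD xn _).
by rewrite rnormB; apply: yc; exact: leq_maxr.
Qed.

(** Points are chosen in decreasing members of [F] whose diameters are at most 1 / (n + 1). The
    constant [c] is left free because lifting a sequence from an ultrapower to families costs a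
    factor 2. *)
Lemma complete_of_seq (X : normedModType K) :
    (forall y : nat -> X,
      (forall m n, (m <= n)%N -> rnorm (y m - y n) <= 1 / m.+1%:R) ->
      exists c x, forall m, rnorm (x - y m) <= c / m.+1%:R) ->
  forall F : set_system X, ProperFilter F -> cauchy F -> cvg F.
Proof.
move=> Xc F FF /cauchy_rnorm Fc.
have /choice[A FA] (n : nat) : exists A, F A /\
    forall x y, A x -> A y -> rnorm (x - y) <= 1 / n.+1%:R.
  by have [|A FA Ad] := Fc (1 / n.+1%:R); [rewrite divr_gt0|exists A].
pose fix B n := if n is m.+1 then B m `&` A n else A 0%N.
have FB n : F (B n).
  elim: n => [|n IH]; first exact: (FA 0%N).1.
  by apply: filterI => //; exact: (FA n.+1).1.
have BA m n : (m <= n)%N -> B n `<=` A m.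
  elim: n => [|n IH]; first by rewrite leqn0 => /eqP ->.
  by rewrite leq_eqVlt => /orP[/eqP -> x []//|/IH Bm x [/Bm]].
have /choice[y By] n : exists y, B n y by apply: filter_ex (FB n).
have [|c [x xy]] := Xc y.
  move=> m n mn; apply: (FA m).2; first exact: (@BA m m).
  exact: (@BA m n) (By n).
apply/cvg_ex; exists x; apply: cvg_to_rnorm => e e0.
have e20 : 0 < e / 2 by rewrite divr_gt0.
have [N1 HN1] := invS_le c e20; have [N2 HN2] := invS_le 1 e20.
pose n := maxn N1 N2.
apply: filterS (FA n).1 => z Az /=.
have -> : x - z = (x - y n) + (y n - z) by rewrite addrA subrK.
rewrite (splitr e); apply: le_trans (rnormD _ _) (lerD _ _).
  by apply: le_trans (xy n) (HN1 _ _); exact: leq_maxl.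
apply: le_trans ((FA n).2 _ _ _ Az) (HN2 _ _); last exact: leq_maxr.
exact: (@BA n n).
Qed.

End Completeness.

(** * Closed subspaces as Banach spaces *)

Section Subspaces.
Variables (R : realType) (k : scalar_kind).
Local Notation K := (scalars R k).

Definition linear_set (X : normedModType K) (S : set X) : Prop :=
  [/\ S 0, forall x y, S x -> S y -> S (x + y) & forall a x, S x -> S (a *: x)].

Definition adherent (X : normedModType K) (S : set X) (x : X) : Prop :=
  forall e : R, 0 < e -> exists2 s, S s & rnorm (x - s) <= e.

Definition closed_subspace (X : normedModType K) (S : set X) : Prop :=
  linear_set S /\ forall x, adherent S x -> S x.

Lemma closure_subspace (X : normedModType K) (S : set X) :
  linear_set S -> closed_subspace (adherent S).
Proof.
move=> [S0 SD SZ]; split; first split.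
- by move=> e e0; exists 0; rewrite ?subrr ?rnorm0 ?ltW.
- move=> x y Sx Sy e e0; have e20 : 0 < e / 2 by rewrite divr_gt0.
  have [s Ss xs] := Sx _ e20; have [t St yt] := Sy _ e20.
  exists (s + t); first exact: SD.
  rewrite opprD addrACA (splitr e).
  exact: le_trans (rnormD _ _) (lerD xs yt).
- move=> a x Sx e e0; have a0 : 0 < abs a + 1 by rewrite ltr_wpDl ?abs_ge0.
  have [|s Ss xs] := Sx (e / (abs a + 1)); first by rewrite divr_gt0.
  exists (a *: s); first exact: SZ.
  rewrite -scalerBr rnormZ -/(abs a).
  apply: le_trans (ler_wpM2l (abs_ge0 a) xs) _.
  by rewrite mulrCA ger_pMr // ler_pdivrMr // mul1r lerDl ler01.
- move=> x Sx e e0; have e20 : 0 < e / 2 by rewrite divr_gt0.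
  have [y Sy xy] := Sx _ e20; have [s Ss ys] := Sy _ e20; exists s => //.
  have -> : x - s = (x - y) + (y - s) by rewrite addrA subrK.
  by rewrite (splitr e); exact: le_trans (rnormD _ _) (lerD xy ys).
Qed.

Section BanachSubspace.
Variables (X : completeNormedModType K) (S : set X).

(** The proof [cS] is a parameter so that the structures on the subspace can be inferred from its
    type. *)
Definition subspace_pred (cS : closed_subspace S) : {pred X} :=
  fun x => `[< S x >].

Lemma subspace_pred_closed (cS : closed_subspace S) :
  GRing.subsemimod_closed (subspace_pred cS).
Proof.
have [[S0 SD SZ] _] := cS; split; first split.
- exact/asboolP.
- by move=> x y /asboolP Sx /asboolP Sy; apply/asboolP; exact: SD.
- by move=> a x /asboolP Sx; apply/asboolP; exact: SZ.
Qed.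

Record banach_subspace (cS : closed_subspace S) := Subspace {
  subspace_val :> X; subspaceP : subspace_val \in subspace_pred cS }.

Variable cS : closed_subspace S.

HB.instance Definition _ := [isSub for @subspace_val cS].
HB.instance Definition _ := [Choice of banach_subspace cS by <:].
HB.instance Definition _ := GRing.SubChoice_isSubLmodule.Build _ _ _
  (banach_subspace cS) (subspace_pred_closed cS).

Definition subspace_norm (x : banach_subspace cS) : K := `|subspace_val x|.

Lemma subspace_normD x y :
  subspace_norm (x + y) <= subspace_norm x + subspace_norm y.
Proof. exact: ler_normD. Qed.

Lemma subspace_normZ a x : subspace_norm (a *: x) = `|a| * subspace_norm x.
Proof. exact: normrZ. Qed.

Lemma subspace_norm0_eq0 x : subspace_norm x = 0 -> x = 0.
Proof. by move=> /normr0_eq0 x0; exact: val_inj. Qed.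

HB.instance Definition _ := Lmodule_isNormed.Build K (banach_subspace cS)
  subspace_normD subspace_normZ subspace_norm0_eq0.

Lemma rnorm_subspace (x : banach_subspace cS) : rnorm x = rnorm (subspace_val x).
Proof. by []. Qed.

Lemma subspace_complete (F : set_system (banach_subspace cS)) :
  ProperFilter F -> cauchy F -> cvg F.
Proof.
apply: complete_of_seq => y yc.
have [x xy] := @cauchy_seq_limit R k X (fun n => subspace_val (y n)) 1 yc.
have Sx : S x.
  apply: cS.2 => e e0; have [n Hn] := invS_le 1 e0.
  exists (subspace_val (y n)); first exact/asboolP/subspaceP.
  by apply: le_trans (xy n) (Hn n _).
have xS : x \in subspace_pred cS by apply/asboolP.
by exists 1, (Subspace xS) => m; exact: xy.
Qed.

HB.instance Definition _ :=
  Uniform_isComplete.Build (banach_subspace cS) subspace_complete.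

Lemma subspace_valP (x : banach_subspace cS) : S (subspace_val x).
Proof. exact/asboolP/subspaceP. Qed.

Lemma subspace_ex x : S x -> exists u : banach_subspace cS, subspace_val u = x.
Proof.
by move=> Sx; have xS : x \in subspace_pred cS; [apply/asboolP|exists (Subspace xS)].
Qed.

End BanachSubspace.

End Subspaces.

(** * Orthogonal projections *)

Lemma small_le0 (R : realType) (x C : R) :
  (forall e, 0 < e -> e <= 1 -> x <= e * C) -> x <= 0.
Proof.
move=> xC; apply: (@natr_bound_le0 _ _ `|C|) => -[|n]; first by rewrite mulr0n.
have n0 : 0 < n.+1%:R :> R by rewrite ltr0n.
rewrite -mulr_natl -ler_pdivlMl //; apply: le_trans (xC n.+1%:R^-1 _ _) _.
- by rewrite invr_gt0.
- by rewrite invf_le1 // ler1n.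
- by rewrite ler_pM2l ?invr_gt0 // ler_norm.
Qed.

Section Hilbertian.
Variables (R : realType) (k : scalar_kind).
Local Notation K := (scalars R k).

Lemma sqn_close (X : normedModType K) (u v : X) (e : R) :
  rnorm (u - v) <= e -> e <= 1 -> `|sqn u - sqn v| <= e * (2 * rnorm u + 1).
Proof.
move=> uv e1; rewrite /sqn.
have : rnorm u <= rnorm (u - v) + rnorm v by rewrite -{1}(subrK v u) rnormD.
have : rnorm v <= rnorm (u - v) + rnorm u.
  by rewrite rnormB -{1}(subrK u v) rnormD.
have := rnorm_ge0 u; have := rnorm_ge0 v; have := rnorm_ge0 (u - v).
move: uv; set a := rnorm u; set b := rnorm v; set c := rnorm (u - v).
move=> ce c0 b0 a0 bca acb; rewrite ler_norml; apply/andP; split; nra.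
Qed.

Definition hilbertian (X : normedModType K) : Prop := forall h : X, hvec h.

Lemma hvec_closed (X : normedModType K) : closed_subspace [set h : X | hvec h].
Proof.
split; first split; [exact: hvec0|exact: hvecD|exact: hvecZ|].
move=> h hadh y.
(* The constants of [sqn_close] at [y + h], at [y - h] and, twice, at [h]. *)
pose C := (2 * rnorm (y + h) + 1) + (2 * rnorm (y - h) + 1) + 2 * (2 * rnorm h + 1).
suff : `|sqn (y + h) + sqn (y - h) - 2 * (sqn y + sqn h)| <= 0.
  by rewrite normr_le0 subr_eq0 => /eqP.
apply: (@small_le0 _ _ C) => e e0 e1; have [s hs sh] := hadh _ e0.
have := @sqn_close X (y + h) (y + s) e; rewrite opprD addrACA subrr add0r.
move=> /(_ sh e1); rewrite ler_norml => /andP[h1 h1'].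
have := @sqn_close X (y - h) (y - s) e.
have -> : y - h - (y - s) = s - h.
  by rewrite opprD opprK addrACA subrr add0r addrC.
rewrite (rnormB s); move=> /(_ sh e1); rewrite ler_norml => /andP[h2 h2'].
have := sqn_close sh e1; rewrite ler_norml => /andP[h3 h3'].
have := hs y; rewrite /C ler_norml => hsy; apply/andP; split; lra.
Qed.

Lemma hvec_iso (X Y : normedModType K) (f : {linear X -> Y}) (h : X) :
  (forall x, rnorm (f x) = rnorm x) -> (forall y, exists x, f x = y) ->
  hvec h <-> hvec (f h).
Proof.
move=> fn fs; have fq x : sqn (f x) = sqn x by rewrite /sqn fn.
split=> hh y; last by rewrite -!fq linearD linearB hh.
by have [x <-] := fs y; rewrite -linearD -linearB !fq hh.
Qed.

Section Projection.
Variables (X : completeNormedModType K) (S : set X).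
Hypotheses (cS : closed_subspace S) (hS : S `<=` [set h | hvec h]).

Definition orthogonal_set : set X := [set z | forall h, S h -> rform z h = 0].

Lemma subspaceB x y : S x -> S y -> S (x - y).
Proof.
have [[_ SD SZ] _] := cS; move=> Sx Sy; apply: SD => //.
by rewrite -scaleN1r; exact: SZ.
Qed.

(* The proof of the Hilbert space projection theorem only uses the
   parallelogram law for vectors of S. *)
Lemma projection (y : X) : exists2 p, S p & orthogonal_set (y - p).
Proof.
have [[S0 SD SZ] Scl] := cS.
pose A := [set sqn (y - p) | p in S]; pose d := inf A.
have A0 : A !=set0 by exists (sqn (y - 0)), 0.
have lbA : has_lbound A by exists 0 => _ [p _ <-]; exact: sqn_ge0.
have dle p : S p -> d <= sqn (y - p) by move=> Sp; apply: ge_inf => //; exists p.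
have d0 : 0 <= d by apply: lb_le_inf => // _ [p _ <-]; exact: sqn_ge0.
pose e (n : nat) : R := 1 / n.+1%:R.
have e0 n : 0 < e n by rewrite divr_gt0 ?ltr0n.
have ele m n : (m <= n)%N -> e n <= e m.
  by move=> mn; rewrite ler_pM2l // lef_pV2 ?posrE ?ltr0n // ler_nat.
have /choice[p pP] n : exists p, S p /\ sqn (y - p) <= d + e n ^+ 2.
  have [|_ [p Sp <-] /ltW pe] := @inf_adherent _ A (e n ^+ 2) _ (conj A0 lbA).
    by rewrite exprn_gt0.
  by exists p.
have [m n mn|x xp] := @cauchy_seq_limit R k X p 2.
  have -> : 2 / m.+1%:R = 2 * e m by rewrite /e mulrA mulr1.
  have [Sm pm] := pP m; have [Sn pn] := pP n.
  have Sh : S (p m - p n) by exact: subspaceB.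
  (* The law at twice the vector from the midpoint of [p m] and [p n] to [y] gives sqn (p m - p n)
     <= 2 (e m)^2 + 2 (e n)^2 <= (2 e m)^2; the slack in the choice of [p] is squared for this
     reason. *)
  have := hS Sh (y + y - p m - p n); rewrite /=.
  have -> : y + y - p m - p n + (p m - p n) = (y - p n) *+ 2.
    by rewrite addrACA subrK addrACA -mulr2n.
  have -> : y + y - p m - p n - (p m - p n) = (y - p m) *+ 2.
    by rewrite opprB addrA subrK -addrA addrACA -mulr2n.
  have Ss : S (2^-1 *: (p m + p n)) by apply: SZ; exact: SD.
  have := dle _ Ss.
  have -> : y + y - p m - p n = (y - 2^-1 *: (p m + p n)) *+ 2.
    rewrite mulrnBl -[_ *: _ *+ 2]scaler_nat scalerA mulfV ?pnatr_eq0 //.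
    by rewrite scale1r mulr2n opprD addrA.
  rewrite !sqnMn => dl par.
  have en : e n ^+ 2 <= e m ^+ 2 by rewrite ler_sqr ?ele // nnegrE ltW.
  have : sqn (p m - p n) <= (2 * e m) ^+ 2 by rewrite exprMn; lra.
  by rewrite /sqn ler_sqr // nnegrE ?rnorm_ge0 // mulr_ge0 ?(ltW (e0 m)).
have Sx : S x.
  apply: Scl => r r0; have [n Hn] := invS_le 2 r0; exists (p n); first exact: (pP n).1.
  by apply: le_trans (xp n) (Hn n _).
exists x => //.
pose D := Num.sqrt d; have D0 : 0 <= D by exact: sqrtr_ge0.
have DD : D ^+ 2 = d by rewrite sqr_sqrtr.
have xD : rnorm (y - x) <= D.
  rewrite -subr_le0; apply: (@natr_bound_le0 _ _ 3) => -[|n]; first by rewrite mulr0n.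
  have [_ pn] := pP n.
  have pnD : rnorm (y - p n) <= D + e n.
    rewrite -ler_sqr ?nnegrE ?rnorm_ge0 ?addr_ge0 ?(ltW (e0 n)) //.
    apply: le_trans pn _; rewrite -DD sqrrD lerD2r lerDl mulrn_wge0 //.
    by rewrite mulr_ge0 ?(ltW (e0 n)).
  have : rnorm (y - x) <= D + e n + 2 / n.+1%:R.
    have -> : y - x = (y - p n) + (p n - x) by rewrite addrA subrK.
    apply: le_trans (rnormD _ _) (lerD pnD _).
    by rewrite rnormB; exact: xp.
  have n0 : 0 < n.+1%:R :> R by rewrite ltr0n.
  rewrite -addrA /e -mulrDl -lerBlDl ler_pdivlMr // mulr_natr.
  by move/le_trans; apply; lra.
have xd : sqn (y - x) <= d by rewrite -DD /sqn ler_sqr ?nnegrE ?rnorm_ge0.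
set z := y - x in xd *.
(* First variation: moving [x] by h / (n + 1) cannot bring it closer to [y]. The opposite sign
   follows by applying this to [- h]. *)
have half h : S h -> - rform z h <= 0.
  move=> Sh; apply: (@natr_bound_le0 _ _ (sqn h)) => -[|n].
    by rewrite mulr0n sqn_ge0.
  pose s : X := n.+1%:R^-1 *: h.
  have Ss : S s by exact: SZ.
  have hE : h = s *+ n.+1.
    by rewrite /s -scaler_nat scalerA mulfV ?scale1r // pnatr_eq0.
  have hs : hvec s by exact: hS.
  have := dle _ (subspaceB Sx Ss); rewrite opprB addrCA addrC -/z.
  rewrite sqn_rformD // hE rformMnr // sqnMn => dl.
  have n1 : 1 <= n.+1%:R :> R by rewrite ler1n.
  rewrite mulNrn -mulr_natl; have := sqn_ge0 s.
  move: dl xd n1; set a := sqn z; set b := sqn s; set c := rform z s.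
  set N := n.+1%:R; nra.
move=> h Sh; apply/le_anti; have := half _ Sh.
have := half _ (subspaceB S0 Sh); rewrite sub0r rformNr; lra.
Qed.

Lemma orthogonal_closed : closed_subspace orthogonal_set.
Proof.
have [[S0 SD SZ] Scl] := cS.
split; first split.
- by move=> h Sh; rewrite rform0l.
- by move=> x y xo yo h Sh; rewrite rformDl ?xo ?yo ?addr0 //; exact: hS.
- move=> a x xo h Sh; have [->|a0] := eqVneq a 0; first by rewrite scale0r rform0l.
  have -> : h = a *: (a^-1 *: h) by rewrite scalerA mulfV // scale1r.
  by rewrite rformZ xo ?mulr0 //; exact: SZ.
- move=> x xadh h Sh; apply/eqP; rewrite -normr_le0.
  apply: (@small_le0 _ _ (rnorm h)) => e e0 e1; have [s so xs] := xadh _ e0.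
  have -> : rform x h = rform (x - s) h.
    by rewrite rformBl ?(so h) ?subr0 //; exact: hS.
  apply: le_trans (rform_norm_le _ (hS Sh)) _.
  by rewrite ler_wpM2r ?rnorm_ge0.
Qed.

Lemma orthogonal_decomposition :
  linearly_isometric (dsum2 (banach_subspace orthogonal_closed) (banach_subspace cS)) X.
Proof.
apply: (@linearly_isometric_intro _ _ _ _
  (fun z : dsum2 (banach_subspace orthogonal_closed) (banach_subspace cS) =>
    subspace_val z.1 + subspace_val z.2)).
- by move=> a x y /=; rewrite scalerDr addrACA.
- move=> [u v] /=; rewrite rnorm_dsum2 /= !rnorm_subspace.
  apply/eqP; rewrite -(eqrXn2 (n := 2)) ?rnorm_ge0 ?hypot_ge0 // sqr_hypot.
  rewrite -!/(sqn _) sqn_rformD; last exact: (hS (subspace_valP v)).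
  by rewrite (subspace_valP u) ?mulr0 ?addr0 //; exact: subspace_valP.
- move=> y; have [p Sp po] := projection y.
  have [u uE] := subspace_ex orthogonal_closed po; have [v vE] := subspace_ex cS Sp.
  by exists ((u, v) : dsum2 _ _); rewrite /= uE vE subrK.
Qed.

End Projection.

End Hilbertian.

(** * The Jordan-von Neumann theorem *)

Section InnerProduct.
Variable R : realType.
Definition iC : scalars R complex_scalars := Complex 0 1.

Lemma abs_iC : abs iC = 1.
Proof. by rewrite /abs /= expr0n expr1n add0r sqrtr1. Qed.

Lemma sqr_iC : iC * iC = -1.
Proof. by apply/eqP; rewrite eq_complex /=; apply/andP; split; apply/eqP; lra. Qed.

(** Multiplying both arguments by the unimodular scalar [iC] leaves [rform] unchanged. *)
Lemma rform_iC (X : normedModType (scalars R complex_scalars)) (x y : X) :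
  rform (iC *: x) y = - rform x (iC *: y).
Proof.
rewrite -[RHS]mul1r -(expr1n R 2) -abs_iC -rformNr -rformZ scalerN scalerA.
by rewrite sqr_iC scaleN1r opprK.
Qed.

Lemma rform_complex (X : normedModType (scalars R complex_scalars)) (p q : R)
    (x y : X) : hvec y ->
  rform ((Complex p q : scalars R complex_scalars) *: x) y =
  p * rform x y - q * rform x (iC *: y).
Proof.
move=> hy; have -> : Complex p q = of_real complex_scalars p +
    of_real complex_scalars q * iC :> scalars R complex_scalars.
  apply/eqP; rewrite eq_complex /=; apply/andP; split; apply/eqP; lra.
by rewrite scalerDl rformDl // -scalerA !rform_real // rform_iC mulrN.
Qed.

(** The product is conjugate linear in [h], so its imaginary part is the real part of the product of
    [y] with i h. *)
Definition inner (k : scalar_kind) :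
    forall X : normedModType (scalars R k), X -> X -> scalars R k :=
  match k with
  | real_scalars => fun X y h => rform y h
  | complex_scalars => fun X y h => Complex (rform y h) (rform y (iC *: h))
  end.
Arguments inner {k X}.

Variable k : scalar_kind.
Local Notation K := (scalars R k).

Lemma innerBl (X : normedModType K) (x y h : X) : hilbertian X ->
  inner (x - y) h = inner x h - inner y h.
Proof.
case: k X x y h => X x y h hX /=; first by rewrite rformBl.
by rewrite !rformBl.
Qed.

Lemma innerC (X : normedModType K) (x y : X) : hilbertian X ->
  inner x y = conjugate (inner y x).
Proof.
case: k X x y => X x y hX /=; first by rewrite rformC.
by rewrite rformC; congr Complex; rewrite -rform_iC rformC.
Qed.

Lemma innerZl (X : normedModType K) (a : K) (x y : X) : hilbertian X ->
  inner (a *: x) y = a * inner x y.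
Proof.
case: k X a x y => X a x y hX /=; first exact: (rform_real a x (hX y)).
case: a => p q; rewrite !rform_complex // scalerA sqr_iC scaleN1r rformNr.
apply/eqP; rewrite eq_complex /=; apply/andP; split; apply/eqP; lra.
Qed.

Lemma inner_diag (X : normedModType K) (x : X) :
  inner x x = of_real k (sqn x).
Proof.
case: k X x => X x /=; first by rewrite rform_diag.
rewrite rform_diag; congr Complex.
by have := rform_iC x x; rewrite rformC; lra.
Qed.

Lemma conjugateM (a b : K) : conjugate (a * b) = conjugate a * conjugate b.
Proof. by case: k a b => //= a b; rewrite rmorphM. Qed.

Lemma conjugateB (a b : K) : conjugate (a - b) = conjugate a - conjugate b.
Proof. by case: k a b => //= a b; rewrite rmorphB. Qed.

Lemma hilbert_spaceP (H : completeNormedModType K) :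
  hilbert_space H <-> hilbertian H.
Proof.
have sqnE (x : H) : of_real k (sqn x) = `|x| ^+ 2.
  by rewrite /sqn expr2 of_realM rnormE -expr2.
split=> [[dot dotE] h y|hH].
  apply: (can_inj (of_realK k)).
  rewrite mulrDr !mulr_natl !mulr2n !of_realD !sqnE -!dotE.
  have Dl (u v w : H) : dot (u + v) w = dot u w + dot v w by exact: linearDl.
  have Dr (u v w : H) : dot w (u + v) = dot w u + dot w v by exact: linearDr.
  have Nl (u w : H) : dot (- u) w = - dot u w by exact: linearNl.
  have Nr (u w : H) : dot w (- u) = - dot w u by exact: linearNr.
  rewrite !(Dl, Dr, Nl, Nr).
  move: (dot y y) (dot y h) (dot h y) (dot h h) => a b c d; ring.
have Bl (z : H) : zmod_morphism (fun x : H => inner x z).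
  by move=> x y; exact: innerBl.
have Br (z : H) : zmod_morphism (fun x : H => inner z x).
  by move=> x y; rewrite innerC // innerBl // conjugateB -!innerC.
have Zl (z : H) : scalable_for *%R (fun x : H => inner x z).
  by move=> a x; exact: innerZl.
have Zr (z : H) : scalable_for (@conjugate R k \; *%R) (fun x : H => inner z x).
  by move=> a x /=; rewrite innerC // innerZl // conjugateM -innerC.
have herm (x y : H) : inner x y = (-1) ^+ false * conjugate (inner y x).
  by rewrite expr0 mul1r; exact: innerC.
have pos (x : H) : x != 0 -> 0 < inner x x.
  move=> x0; rewrite inner_diag -(of_real0 R k) ltr_of_real lt_def sqn_ge0 andbT.
  by apply: contra_neq x0 => /sqn_eq0.
pose b1 := isBilinear.Build K H H K *%R (@conjugate R k \; *%R)
  (fun x y : H => inner x y) Bl Br Zl Zr.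
pose b2 := isHermitianSesquilinear.Build K H false (@conjugate R k)
  (fun x y : H => inner x y) herm.
pose b3 := isDotProduct.Build K H (fun x y : H => inner x y) pos.
pose dot : {dot H for @conjugate R k} :=
  HB.pack (fun x y : H => inner x y) b1 b2 b3.
by exists dot => x; rewrite -sqnE; exact: inner_diag.
Qed.

End InnerProduct.

(** * Orthonormal families *)

Section OrthonormalFamilies.
Variables (R : realType) (k : scalar_kind).
Local Notation K := (scalars R k).
Implicit Types X Y : normedModType K.

(** All multiples [a], [b] are tested because [rform] is only the real part of an inner product. The
    condition makes sense in every normed space, Hilbertian or not. *)
Definition orthonormal_family (T : Type) X (e : T -> X) : Prop :=
  (forall t, rnorm (e t) = 1) /\
  forall s t, s <> t -> forall a b, rform (a *: e s) (b *: e t) = 0.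

(** Lists of pairs, possibly with repeated indices, work over index types without decidable
    equality. *)
Definition comb (T : Type) X (e : T -> X) (s : seq (K * T)) : X :=
  \sum_(p <- s) p.1 *: e p.2.

Definition total_family (T : Type) X (e : T -> X) : Prop :=
  forall x, adherent (range (comb e)) x.

Lemma comb_cons (T : Type) X (e : T -> X) p s :
  comb e (p :: s) = p.1 *: e p.2 + comb e s.
Proof. exact: big_cons. Qed.

Lemma comb_cat (T : Type) X (e : T -> X) s t :
  comb e (s ++ t) = comb e s + comb e t.
Proof. exact: big_cat. Qed.

Lemma comb_scale (T : Type) X (e : T -> X) a s :
  comb e [seq (a * p.1, p.2) | p <- s] = a *: comb e s.
Proof.
rewrite /comb big_map scaler_sumr; apply: eq_bigr => p _.
by rewrite scalerA.
Qed.

Lemma comb_linear_set (T : Type) X (e : T -> X) : linear_set (range (comb e)).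
Proof.
split; first by exists [::] => //; rewrite /comb big_nil.
- by move=> _ _ [s _ <-] [t _ <-]; exists (s ++ t) => //; rewrite comb_cat.
- by move=> a _ [s _ <-]; exists [seq (a * p.1, p.2) | p <- s]; rewrite ?comb_scale.
Qed.

Lemma comb_mem (T : Type) X (e : T -> X) t : range (comb e) (e t).
Proof. by exists [:: (1, t)]; rewrite // /comb big_seq1 scale1r. Qed.

Lemma sqn_unit (T : Type) X (e : T -> X) t : orthonormal_family e -> sqn (e t) = 1.
Proof. by move=> [e1 _]; rewrite /sqn e1 expr1n. Qed.

Lemma rform_family (T : Type) X Y (e : T -> X) (f : T -> Y) a b s t :
  orthonormal_family e -> orthonormal_family f ->
  rform (a *: e s) (b *: e t) = rform (a *: f s) (b *: f t).
Proof.
move=> eo fo; have [<-|st] := pselect (s = t).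
  by rewrite /rform -!scalerDl -!scalerBl !sqnZ !(sqn_unit _ eo, sqn_unit _ fo).
by rewrite eo.2 // fo.2.
Qed.

(** Indices may repeat, so there is no plain sum of squares to compute; the two families are
    compared term by term through [rform] instead. *)
Lemma sqn_comb (T : Type) X Y (e : T -> X) (f : T -> Y) s :
  hilbertian X -> hilbertian Y -> orthonormal_family e -> orthonormal_family f ->
  sqn (comb e s) = sqn (comb f s).
Proof.
move=> hX hY eo fo.
have crossE a t s' : rform (comb e s') (a *: e t) = rform (comb f s') (a *: f t).
  elim: s' => [|p s' IH]; first by rewrite /comb !big_nil !rform0l.
  by rewrite !comb_cons !rformDl // IH (rform_family _ _ _ _ eo fo).
elim: s => [|p s IH]; first by rewrite /comb !big_nil !sqn0.
rewrite !comb_cons !(addrC (_ *: _)) !sqn_rformD // IH crossE.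
by rewrite !sqnZ !(sqn_unit _ eo, sqn_unit _ fo).
Qed.

(** The Hilbert space value sqrt 2 can fail in a general normed space. Orthogonality makes the norms
    of [e s + e t] and [e s - e t] equal, and midpoint convexity at [e s *+ 2] yields 1. *)
Lemma orthonormal_inj (T : Type) X (e : T -> X) : orthonormal_family e ->
  forall s t, s <> t -> 1 <= rnorm (e s - e t).
Proof.
move=> eo s t st; rewrite -ler_sqr ?nnegrE ?ler01 ?rnorm_ge0 // expr1n -/(sqn _).
have h0 : rform (e s) (e t) = 0 by have := eo.2 s t st 1 1; rewrite !scale1r.
move: h0; rewrite /rform.
have := sqn_midpoint (e s + e t) (e s - e t).
have -> : e s + e t + (e s - e t) = e s *+ 2.
  by rewrite addrACA subrr addr0 mulr2n.
by rewrite sqnMn sqn_unit //; lra.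
Qed.

(** The closure [H] of the relation [G] is the graph of the isometry. A relation spares the proof
    that sending one combination to another is well defined: preservation of norms implies it. *)
Lemma extend_isometry (X Y : completeNormedModType K) (G : X -> Y -> Prop) :
  (forall a x y x' y', G x y -> G x' y' -> G (a *: x + x') (a *: y + y')) ->
  (forall x y, G x y -> rnorm x = rnorm y) ->
  (forall x, adherent [set u | exists v, G u v] x) ->
  (forall y, adherent [set v | exists u, G u v] y) ->
  linearly_isometric X Y.
Proof.
move=> Glin Gnorm GX GY.
pose H x y := forall e : R, 0 < e ->
  exists u v, [/\ G u v, rnorm (x - u) <= e & rnorm (y - v) <= e].
have Hlin a x y x' y' : H x y -> H x' y' -> H (a *: x + x') (a *: y + y').
  move=> xy xy' e e0; have e20 : 0 < e / 2 by rewrite divr_gt0.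
  have a0 : 0 < abs a + 1 by rewrite ltr_wpDl ?abs_ge0.
  have [|u [v [Guv xu yv]]] := xy (e / 2 / (abs a + 1)); first by rewrite divr_gt0.
  have [u' [v' [Guv' xu' yv']]] := xy' _ e20.
  exists (a *: u + u'), (a *: v + v'); split; first exact: Glin.
    rewrite opprD addrACA -scalerBr (splitr e).
    apply: le_trans (rnormD _ _) (lerD _ xu').
    rewrite rnormZ -/(abs a); apply: le_trans (ler_wpM2l (abs_ge0 a) xu) _.
    by rewrite mulrCA ger_pMr // ler_pdivrMr // mul1r lerDl ler01.
  rewrite opprD addrACA -scalerBr (splitr e).
  apply: le_trans (rnormD _ _) (lerD _ yv').
  rewrite rnormZ -/(abs a); apply: le_trans (ler_wpM2l (abs_ge0 a) yv) _.
  by rewrite mulrCA ger_pMr // ler_pdivrMr // mul1r lerDl ler01.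
have rn (Z : normedModType K) (z w : Z) e : rnorm (z - w) <= e ->
    rnorm z <= rnorm w + e /\ rnorm w <= rnorm z + e.
  move=> zw; split; first by have := rnormD (z - w) w; rewrite subrK; lra.
  by have := rnormD (w - z) z; rewrite subrK rnormB; lra.
have Hnorm x y : H x y -> rnorm x = rnorm y.
  move=> xy; suff : `|rnorm x - rnorm y| <= 0.
    by rewrite normr_le0 subr_eq0 => /eqP.
  apply: (@small_le0 _ _ 2) => e e0 _.
  have [u [v [/Gnorm uv /rn[xu ux] /rn[yv vy]]]] := xy _ e0.
  by rewrite ler_norml; apply/andP; split; lra.
have Gsub u v u' v' : G u v -> G u' v' -> rnorm (u - u') = rnorm (v - v').
  move=> uv uv'; apply: Gnorm; rewrite addrC -scaleN1r [v - _]addrC -(scaleN1r v').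
  exact: Glin.
(* Stated for any relation, because it serves [G] for totality and its converse for surjectivity. *)
have lim (Z W : completeNormedModType K) (F : Z -> W -> Prop) (z : Z) :
    (forall u v u' v', F u v -> F u' v' -> rnorm (u - u') = rnorm (v - v')) ->
    adherent [set u | exists v, F u v] z ->
    exists w, forall e : R, 0 < e ->
      exists u v, [/\ F u v, rnorm (z - u) <= e & rnorm (w - v) <= e].
  move=> Fsub adh.
  have /choice[u /choice[v uv]] n : exists u, exists v,
      F u v /\ rnorm (z - u) <= 1 / n.+1%:R.
    by have [|u [v Fuv] zu] := adh (1 / n.+1%:R); [rewrite divr_gt0|exists u, v].
  have [m n mn|w wv] := @cauchy_seq_limit R k W v 2.
    rewrite -(Fsub _ _ _ _ (uv m).1 (uv n).1).
    have -> : u m - u n = (u m - z) + (z - u n) by rewrite addrA subrK.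
    apply: le_trans (rnormD _ _) _; rewrite rnormB.
    apply: le_trans (lerD (uv m).2 (uv n).2) _.
    rewrite [leRHS](_ : _ = 1 / m.+1%:R + 1 / m.+1%:R); last by rewrite -mulrDl.
    by rewrite lerD2l ler_pM2l // lef_pV2 ?posrE ?ltr0n // ler_nat.
  exists w => e e0; have [n Hn] := invS_le 2 e0.
  exists (u n), (v n); split; first exact: (uv n).1.
    apply: le_trans (uv n).2 (le_trans _ (Hn n _)) => //.
    by rewrite ler_pM2r ?invr_gt0 // ler1n.
  exact: le_trans (wv n) (Hn n _).
have Htot x : exists y, H x y by apply: (lim _ _ G) => //; exact: Gsub.
have Hsurj y : exists x, H x y.
  have [||x Hx] := @lim Y X (fun v u => G u v) y; first 2 last.
  - by exists x => e /Hx[v [u [? ? ?]]]; exists u, v.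
  - by move=> v u v' u' vu vu'; rewrite (Gsub _ _ _ _ vu vu').
  - exact: GY.
have Huniq x y y' : H x y -> H x y' -> y = y'.
  move=> xy xy'; apply/subr0_eq/rnorm0_eq0.
  have := Hlin (-1) _ _ _ _ xy' xy.
  by rewrite !scaleN1r addNr addrC => /Hnorm <-; rewrite rnorm0.
have [f fH] := choice Htot.
apply: (@linearly_isometric_intro _ _ _ _ f).
- by move=> a x y; apply: Huniq (fH _) _; exact: Hlin.
- by move=> x; rewrite (Hnorm _ _ (fH x)).
- by move=> y; have [x xy] := Hsurj y; exists x; apply: Huniq (fH _) xy.
Qed.

Lemma orthonormal_isometry (T : Type) (X Y : completeNormedModType K)
    (e : T -> X) (f : T -> Y) : hilbertian X -> hilbertian Y ->
  orthonormal_family e -> orthonormal_family f ->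
  total_family e -> total_family f -> linearly_isometric X Y.
Proof.
move=> hX hY eo fo et ft.
apply: (@extend_isometry X Y (fun x y => exists s, x = comb e s /\ y = comb f s)).
- move=> a _ _ _ _ [s [-> ->]] [t [-> ->]].
  by exists ([seq (a * p.1, p.2) | p <- s] ++ t); rewrite !comb_cat !comb_scale.
- move=> _ _ [s [-> ->]]; apply/eqP; rewrite -(eqrXn2 (n := 2)) ?rnorm_ge0 //.
  by rewrite -!/(sqn _) (sqn_comb s hX hY eo fo).
- move=> x r r0; have [_ [s _ <-] xs] := et x r r0; exists (comb e s) => //.
  by exists (comb f s), s.
- move=> x r r0; have [_ [s _ <-] xs] := ft x r r0; exists (comb f s) => //.
  by exists (comb e s), s.
Qed.

Lemma orthonormal_reindex (T S : Type) X (e : T -> X) (g : S -> T) :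
  injective g -> orthonormal_family e -> orthonormal_family (e \o g).
Proof.
move=> gI [e1 eo]; split=> [s|s t st a b]; first exact: e1.
by apply: eo => /gI.
Qed.

Lemma total_reindex (T S : Type) X (e : T -> X) (g : S -> T) :
  (forall t, exists s, g s = t) -> total_family e -> total_family (e \o g).
Proof.
move=> /choice[h gh] et x r r0; have [_ [s _ <-] xs] := et x r r0.
exists (comb e s) => //; exists [seq (p.1, h p.2) | p <- s] => //.
by rewrite /comb big_map; apply: eq_bigr => p _ /=; rewrite gh.
Qed.

Lemma orthonormal_card_isometry (T S : Type) (X Y : completeNormedModType K)
    (e : T -> X) (f : S -> Y) : hilbertian X -> hilbertian Y ->
  orthonormal_family e -> orthonormal_family f ->
  total_family e -> total_family f -> embeds T S -> embeds S T ->
  linearly_isometric X Y.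
Proof.
move=> hX hY eo fo et ft TS ST; have [g gI gs] := embeds_bij TS ST.
apply: (@orthonormal_isometry T _ _ e (f \o g)) => //.
  exact: orthonormal_reindex.
exact: total_reindex.
Qed.

(** Zorn's lemma on orthonormal sets containing the range of [e]. The two embeddings bound the
    dimension from both sides when the space is an ultrapower. *)
Lemma orthonormal_basis_above (X : completeNormedModType K) (T : Type)
    (e : T -> X) : hilbertian X -> orthonormal_family e ->
  exists (B : Type) (g : B -> X),
    [/\ orthonormal_family g, total_family g, embeds T B & embeds B X].
Proof.
move=> hX eo.
pose P (A : set X) := (forall x, A x -> rnorm x = 1) /\
  forall x y, A x -> A y -> x <> y -> forall a b, rform (a *: x) (b *: y) = 0.
have [||A [[A1 Ao] eA Amax]] := @Zorn_above X P (range e).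
- split=> [_ [t _ <-]|_ _ [s _ <-] [t _ <-] st]; first exact: eo.1.
  by apply: eo.2 => stE; apply: st; rewrite stE.
- move=> F F0 FP totF; split=> [x [B FB Bx]|x y [B FB Bx] [C FC Cy]].
    exact: (FP _ FB).1.
  have [BC|CB] := totF _ _ FB FC.
    by apply: (FP _ FC).2 => //; exact: BC.
  by apply: (FP _ FB).2 => //; exact: CB.
pose g (x : A) : X := val x.
have Ag (x : A) : A (g x) by exact: set_valP.
have go : orthonormal_family g.
  split=> [x|x y xy]; first exact: A1.
  by apply: Ao => // gxy; apply: xy; exact: val_inj.
exists A, g; split=> //; last by exists g; exact: val_inj.
- move=> y; pose S := adherent (range (comb g)).
  have cS : closed_subspace S by exact/closure_subspace/comb_linear_set.
  have hS : S `<=` [set h | hvec h] by move=> h _; exact: hX.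
  have AS x : A x -> S x.
    move=> Ax r r0; exists x; last by rewrite subrr rnorm0 ltW.
    exact: (comb_mem g (SigSub (mem_set Ax))).
  have [p Sp po] := projection cS hS y.
  have [/subr0_eq -> //|z0] := eqVneq (y - p) 0.
  exfalso; set z := y - p in po z0.
  pose c : K := of_real k (rnorm z)^-1; pose u := c *: z.
  have nz : rnorm z != 0 by apply: contra_neq z0 => /rnorm0_eq0.
  have u1 : rnorm u = 1.
    by rewrite rnormZ -/(abs c) abs_of_real ger0_norm ?invr_ge0 ?rnorm_ge0 // mulVf.
  have [[_ _ SZ] _] := cS; have [[_ _ OZ] _] := orthogonal_closed cS hS.
  have uA : A u.
    rewrite -(Amax (u |` A)); [by left|by right|split].
      by move=> x [->//|/A1].
    move=> x x' [->|Ax] [->|Ax'] xx' a b //.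
    + by have /(_ (b *: x')) := OZ a _ (OZ c _ po); apply; exact/SZ/AS.
    + rewrite rformC; have /(_ (a *: x)) := OZ b _ (OZ c _ po); apply.
      exact/SZ/AS.
    + exact: Ao.
  (* By maximality [u] lies in the span to which it is orthogonal, against its norm 1. *)
  have := OZ c _ po u (AS _ uA); rewrite rform_diag /sqn u1 expr1n => /eqP.
  by rewrite oner_eq0.
- exists (fun t => SigSub (mem_set (eA _ (imageT e t))) : A) => s t [st].
  apply: contrapT => /(orthonormal_inj eo); rewrite st subrr rnorm0.
  by rewrite ler10.
Qed.

Lemma orthonormal_basis (X : completeNormedModType K) : hilbertian X ->
  exists (B : Type) (g : B -> X), orthonormal_family g /\ total_family g.
Proof.
move=> hX; have [||B [g [go gt _ _]]] :=
  @orthonormal_basis_above X False (fun t => match t with end) => //.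
by exists B, g.
Qed.

Lemma rform_dsum2 X Y (z w : dsum2 X Y) :
  rform z w = rform z.1 w.1 + rform z.2 w.2.
Proof. by rewrite /rform /sqn !rnorm_dsum2 !sqr_hypot /=; lra. Qed.

Lemma sqn_dsum2 X Y (z : dsum2 X Y) : sqn z = sqn z.1 + sqn z.2.
Proof. by rewrite /sqn rnorm_dsum2 sqr_hypot. Qed.

Lemma hvec_dsum2 X Y (z : dsum2 X Y) : hvec z.1 -> hvec z.2 -> hvec z.
Proof.
move=> z1 z2 y; rewrite !sqn_dsum2 /=.
by have := z1 y.1; have := z2 y.2; lra.
Qed.

Lemma hilbertian_dsum2 X Y : hilbertian X -> hilbertian Y ->
  hilbertian (dsum2 X Y).
Proof. by move=> hX hY z; apply: hvec_dsum2. Qed.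

Definition sum_family (T S : Type) X Y (e : T -> X) (f : S -> Y) (i : T + S) :
    dsum2 X Y :=
  match i with inl t => (e t, 0) | inr s => (0, f s) end.

Lemma orthonormal_sum (T S : Type) X Y (e : T -> X) (f : S -> Y) :
  orthonormal_family e -> orthonormal_family f ->
  orthonormal_family (sum_family e f).
Proof.
move=> [e1 eo] [f1 fo]; split=> [[t|s]|[t|s] [t'|s'] ts a b].
- by rewrite rnorm_dsum2 /= e1 rnorm0 /hypot expr1n expr0n addr0 sqrtr1.
- by rewrite rnorm_dsum2 /= f1 rnorm0 /hypot expr1n expr0n add0r sqrtr1.
- rewrite rform_dsum2 /= !scaler0 rform0l addr0; apply: eo => tt.
  by apply: ts; rewrite tt.
- by rewrite rform_dsum2 /= !scaler0 rform0l rform0r addr0.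
- by rewrite rform_dsum2 /= !scaler0 rform0l rform0r addr0.
- rewrite rform_dsum2 /= !scaler0 rform0l add0r; apply: fo => tt.
  by apply: ts; rewrite tt.
Qed.

Lemma total_sum (T S : Type) X Y (e : T -> X) (f : S -> Y) :
  total_family e -> total_family f -> total_family (sum_family e f).
Proof.
move=> et ft [x y] r r0; have r20 : 0 < r / 2 by rewrite divr_gt0.
have [_ [s _ <-] xs] := et x _ r20; have [_ [t _ <-] yt] := ft y _ r20.
exists ((comb e s, comb f t) : dsum2 X Y); last first.
  rewrite rnorm_dsum2 /= (splitr r) (le_trans (hypot_ler_norm _ _)) //.
  by rewrite !ger0_norm ?rnorm_ge0 // lerD.
exists ([seq (p.1, inl p.2) | p <- s] ++ [seq (p.1, inr p.2) | p <- t]) => //.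
rewrite comb_cat /comb !big_map /=.
have -> : \sum_(p <- s) p.1 *: ((e p.2, 0) : dsum2 X Y) = (comb e s, 0).
  elim: s {xs} => [|p s IH]; first by rewrite /comb !big_nil.
  rewrite big_cons IH comb_cons; congr pair; by rewrite /= scaler0 addr0.
have -> : \sum_(p <- t) p.1 *: ((0, f p.2) : dsum2 X Y) = (0, comb f t).
  elim: t {yt} => [|p t IH]; first by rewrite /comb !big_nil.
  rewrite big_cons IH comb_cons; congr pair; by rewrite /= scaler0 addr0.
by congr pair; rewrite /= ?addr0 ?add0r.
Qed.

End OrthonormalFamilies.

(** * Ultrapowers *)

Section Ultrapowers.
Variables (R : realType) (k : scalar_kind) (I : Type) (U : set_system I).
Hypothesis UU : UltraFilter U.
Local Notation K := (scalars R k).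
Local Notation "X ^U" := (ultrapower UU X) (at level 2, format "X ^U").

Lemma ultra_cvg_unique (f : I -> R) (a b : R) : f @ U --> a -> f @ U --> b -> a = b.
Proof. by move=> fa fb; rewrite -(cvg_lim _ fa) // (cvg_lim _ fb). Qed.

Section UltrapowerClasses.
Variable X : normedModType K.

Definition ucls (x : linfty I X) : X^U := (\pi_(X^U) x)%qT.

Lemma ucls_surj (q : X^U) : exists x, ucls x = q.
Proof. by exists (repr q); exact: reprK. Qed.

Lemma uclsP a (x y : linfty I X) : ucls (a *: x + y) = a *: ucls x + ucls y.
Proof. by rewrite /ucls pi_ultrapowerD pi_ultrapowerZ. Qed.

Lemma uclsD (x y : linfty I X) : ucls (x + y) = ucls x + ucls y.
Proof. exact: pi_ultrapowerD. Qed.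

Lemma uclsB (x y : linfty I X) : ucls (x - y) = ucls x - ucls y.
Proof. by rewrite addrC -scaleN1r uclsP scaleN1r addrC. Qed.

Lemma rnorm_cvg (x : linfty I X) : rnorm (x i) @[i --> U] --> rnorm (ucls x).
Proof.
have -> : rnorm (ucls x) = ultraseminorm U x.
  by rewrite /rnorm -[`|_|]/(ultrapower_norm _) ultrapower_norm_pi of_realK.
exact: ultraseminorm_cvg.
Qed.
Arguments rnorm_cvg : clear implicits.

Lemma sqn_cvg (x : linfty I X) : sqn (x i) @[i --> U] --> sqn (ucls x).
Proof.
have := cvgM (rnorm_cvg x) (rnorm_cvg x); rewrite -expr2 => xx.
by rewrite /sqn; under eq_fun do rewrite expr2; exact: xx.
Qed.
Arguments sqn_cvg : clear implicits.

Lemma rnorm_ucls_le (x : linfty I X) c :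
  U [set i | rnorm (x i) <= c] -> rnorm (ucls x) <= c.
Proof. exact: (cvgr_to_le (rnorm_cvg x)). Qed.

Lemma near_rnorm_ucls (x : linfty I X) c :
  rnorm (ucls x) < c -> U [set i | rnorm (x i) <= c].
Proof.
move=> xc; apply: filterS (cvgr_lt _ (rnorm_cvg x) _ xc) => i.
exact: ltW.
Qed.

Lemma sqn_ucls (x : linfty I X) l : sqn (x i) @[i --> U] --> l -> sqn (ucls x) = l.
Proof. by move=> xl; apply: ultra_cvg_unique (sqn_cvg x) xl. Qed.

Lemma linfty_ex (x : I -> X) (M : R) : (forall i, rnorm (x i) <= M) ->
  exists u : linfty I X, linfty_val u = x.
Proof.
by move=> xM; have xb : x \in @bounded_family _ _ _ _;
  [apply/asboolP; exists M|exists (Linfty xb)].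
Qed.

Lemma embeds_ultrapower : embeds X^U (I -> X).
Proof.
exists (fun q => linfty_val (repr q)) => p q pq.
by rewrite -[p]reprK -[q]reprK; congr (\pi_(X^U)%qT); exact: val_inj.
Qed.

Lemma diag_subproof (x : X) : (fun _ : I => x) \in @bounded_family _ _ _ _.
Proof. by apply/asboolP; exists (rnorm x). Qed.

Definition udiag (x : X) : X^U := ucls (Linfty (diag_subproof x)).

Lemma udiagP a x y : udiag (a *: x + y) = a *: udiag x + udiag y.
Proof. by rewrite -uclsP; congr ucls; exact: val_inj. Qed.

Lemma rnorm_udiag x : rnorm (udiag x) = rnorm x.
Proof.
apply: ultra_cvg_unique (rnorm_cvg (Linfty (diag_subproof x))) _.
exact: cvg_cst.
Qed.

Lemma hilbertian_ultrapower : hilbertian X -> hilbertian X^U.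
Proof.
move=> hX q p; have [x <-] := ucls_surj q; have [y <-] := ucls_surj p.
rewrite -uclsD -uclsB.
have h1 : sqn ((y + x) i) + sqn ((y - x) i) @[i --> U] -->
    sqn (ucls (y + x)) + sqn (ucls (y - x)) by apply: cvgD; exact: sqn_cvg.
have h2 : 2 * (sqn (y i) + sqn (x i)) @[i --> U] --> 2 * (sqn (ucls y) + sqn (ucls x)).
  by apply: cvgMr; apply: cvgD; exact: sqn_cvg.
apply: (ultra_cvg_unique h1); move: h2.
by under eq_fun do rewrite -(hX (x _) (y _)); apply.
Qed.

End UltrapowerClasses.
Arguments rnorm_cvg {X} x.
Arguments sqn_cvg {X} x.

Section UltrapowerComplete.
Variable X : completeNormedModType K.

(* An almost Cauchy sequence y has a point close to those of its terms that
   precede the first failure of the Cauchy estimates. *)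
Lemma almost_limit (y : nat -> X) :
  exists x, forall N,
    (forall m n, (m <= n <= N)%N -> rnorm (y m - y n) <= 2 / m.+1%:R) ->
    rnorm (x - y N) <= 2 / N.+1%:R.
Proof.
pose ok N := `[< forall m n, (m <= n <= N)%N ->
  rnorm (y m - y n) <= 2 / m.+1%:R >].
have [allok|/existsNP[N /negP nokN]] := pselect (forall N, ok N).
  have [m n mn|x xy] := @cauchy_seq_limit R k X y 2.
    by have /asboolP := allok n; apply; rewrite mn /=.
  by exists x => N _; exact: xy.
have nok : exists N, ~~ ok N by exists N.
case: (ex_minnP nok) => -[|n] nokn nmin.
  exfalso; move/asboolP: nokn; apply => m n.
  case/andP; rewrite leqn0 => mn /eqP n0; move: mn; rewrite n0 leqn0 => /eqP ->.
  by rewrite subrr rnorm0 divr_ge0.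
have /asboolP okn : ok n.
  by apply: contraT => /nmin; rewrite ltnn.
exists (y n) => M okM; rewrite rnormB; apply: okn; rewrite leqnn andbT leqNgt.
apply/negP => nM; move/asboolP: nokn; apply => a b /andP[ab bn].
by apply: okM; rewrite ab (leq_trans bn).
Qed.

Lemma ultrapower_complete (F : set_system X^U) :
  ProperFilter F -> cauchy F -> cvg F.
Proof.
apply: complete_of_seq => q qc.
have /choice[y yq] n := ucls_surj (q n).
have /choice[x xP] i := almost_limit (fun n => y n i).
have [M yM] : exists M, forall i, rnorm (y 0%N i) <= M.
  by have /asboolP := linftyP (y 0%N).
(* For N = 0 the condition in [almost_limit] is trivial, so every [x i] is within 2 of [y 0%N i],
   not merely almost every one. *)
have xM i : rnorm (x i) <= 2 + M.
  rewrite -[x i](subrK (y 0%N i)); apply: le_trans (rnormD _ _) (lerD _ (yM i)).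
  have := xP i 0%N; rewrite divr1; apply=> m n.
  case/andP; rewrite leqn0 => mn /eqP n0; move: mn; rewrite n0 leqn0 => /eqP ->.
  by rewrite subrr rnorm0 divr_ge0.
have [u uE] := linfty_ex xM.
exists 2, (ucls u) => N; rewrite -yq -uclsB; apply: rnorm_ucls_le.
(* Only finitely many estimates are needed for a given N, so they hold together almost everywhere;
   doubling the rate gives the strict inequality required by [near_rnorm_ucls]. *)
have ok : U [set i | forall m n : 'I_N.+1, (m <= n)%N ->
    rnorm (y m i - y n i) <= 2 / m.+1%:R].
  apply: filter_forall => m; apply: filter_forall => n.
  have [mn|nm] := leqP m n; last exact: filterE.
  have ynm : rnorm (ucls (y m - y n)) < 2 / m.+1%:R.
    rewrite uclsB !yq; apply: le_lt_trans (qc _ _ mn) _.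
    by rewrite ltr_pM2r ?invr_gt0 // ltr1n.
  by apply: filterS (near_rnorm_ucls ynm).
apply: filterS ok => i ok.
suff : rnorm (x i - y N i) <= 2 / N.+1%:R by rewrite -uE.
apply: xP => m n /andP[mn nN].
have nN' : (n < N.+1)%N by [].
have mN' : (m < N.+1)%N by rewrite ltnS (leq_trans mn).
exact: (ok (Ordinal mN') (Ordinal nN')).
Qed.

HB.instance Definition _ :=
  Uniform_isComplete.Build X^U ultrapower_complete.

End UltrapowerComplete.

Lemma ultrapower_iso (X Y : normedModType K) :
  linearly_isometric X Y -> linearly_isometric X^U Y^U.
Proof.
move=> /linearly_isometric_elim[f [fn fs]].
have fb (x : linfty I X) : (fun i => f (x i)) \in @bounded_family _ _ _ _.
  have /asboolP[M xM] := linftyP x; apply/asboolP; exists M => i.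
  by rewrite fn.
pose g x := ucls (Linfty (fb x)).
have glin a x y : g (a *: x + y) = a *: g x + g y.
  by rewrite -uclsP; congr ucls; apply/val_inj/funext => i; exact: linearP.
have gn x : rnorm (g x) = rnorm (ucls x).
  apply: ultra_cvg_unique (rnorm_cvg _) _; rewrite /=.
  by under eq_fun do rewrite fn; exact: rnorm_cvg.
have gB x y : g (x - y) = g x - g y.
  by rewrite addrC -scaleN1r glin scaleN1r addrC.
have gE x y : ucls x = ucls y -> g x = g y.
  by move=> xy; apply/subr0_eq/rnorm0_eq0; rewrite -gB gn uclsB xy subrr rnorm0.
have rK (q : X^U) : ucls (repr q) = q := reprK q.
apply: (@linearly_isometric_intro _ _ _ _ (fun q : X^U => g (repr q))).
- by move=> a p q; rewrite -glin; apply: gE; rewrite uclsP !rK.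
- by move=> q; rewrite gn rK.
- move=> q; have [y <-] := ucls_surj q; have [h fh] := choice fs.
  have [x xE] : exists x : linfty I X, linfty_val x = h \o y.
    have /asboolP[M yM] := linftyP y.
    by apply: (@linfty_ex _ _ M) => i; rewrite -fn /= fh.
  exists (ucls x); have -> : g (repr (ucls x)) = g x by apply: gE; rewrite rK.
  by congr ucls; apply/val_inj/funext => i /=; rewrite xE /= fh.
Qed.

End Ultrapowers.
Arguments rnorm_cvg {R k I U} UU {X} x.
Arguments sqn_cvg {R k I U} UU {X} x.
Arguments ultra_cvg_unique {R I U} UU [f a b].

(** * Ultrafilter limits and finite dimensional spans *)

Section UltraLimits.
Variables (R : realType) (k : scalar_kind).
Local Notation K := (scalars R k).

Definition ultra_limit (I : Type) (U : set_system I) (X : normedModType K)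
    (x : I -> X) (l : X) : Prop :=
  forall e : R, 0 < e -> U [set i | rnorm (x i - l) <= e].

Lemma real_ultra_limit (I : Type) (U : set_system I) (UU : UltraFilter U)
    (f : I -> R) (M : R) : (forall i, `|f i| <= M) ->
  exists l, forall e : R, 0 < e -> U [set i | `|f i - l| <= e].
Proof.
move=> fM; have : cvg (f @ U).
  by apply: (@ultra_is_cvg R I U UU f (- M) M) => i; rewrite -ler_norml.
move=> /cvg_ex[l /cvgrPdist_le fl]; exists l => e e0.
by apply: filterS (fl _ e0) => i /=; rewrite distrC.
Qed.

Lemma scalar_ultra_limit (I : Type) (U : set_system I) (UU : UltraFilter U)
    (c : I -> K) (M : R) : (forall i, abs (c i) <= M) ->
  exists l, forall e : R, 0 < e -> U [set i | abs (c i - l) <= e].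
Proof.
case: k c => c cM; first exact: real_ultra_limit cM.
have Re_le (z : R[i]) : `|complex.Re z| <= Normc.normc z.
  by case: z => a b /=; rewrite -sqrtr_sqr ler_wsqrtr// lerDl sqr_ge0.
have Im_le (z : R[i]) : `|complex.Im z| <= Normc.normc z.
  by case: z => a b /=; rewrite -sqrtr_sqr ler_wsqrtr// lerDr sqr_ge0.
have [a Ha] := real_ultra_limit UU (fun i => le_trans (Re_le (c i)) (cM i)).
have [b Hb] := real_ultra_limit UU (fun i => le_trans (Im_le (c i)) (cM i)).
exists (Complex a b) => e e0; have e20 : 0 < e / 2 by rewrite divr_gt0.
apply: filterS2 (Ha _ e20) (Hb _ e20) => i /=.
case: (c i) => p q /= pa qb; rewrite (splitr e).
exact: le_trans (sqrtr_le_normD _ _) (lerD pa qb).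
Qed.

Section Span.
Variables (X : normedModType K) (e : nat -> X).

(** Generators are indexed by [nat], so the family stays the same during inductions on [n]. *)
Definition nspan (n : nat) : set X :=
  [set x | exists c : nat -> K, x = \sum_(i < n) c i *: e i].

Lemma nspanS n x : nspan n.+1 x <-> exists a v, nspan n v /\ x = a *: e n + v.
Proof.
split=> [[c ->]|[a [v [[c ->] ->]]]].
  by exists (c n), (\sum_(i < n) c i *: e i); split; [exists c|rewrite big_ord_recr addrC].
exists (fun i => if i == n then a else c i); rewrite big_ord_recr /= eqxx addrC.
by congr (_ + _); apply: eq_bigr => i _; rewrite ltn_eqF.
Qed.

Lemma nspan_linear n : linear_set (nspan n).
Proof.
split.
- by exists (fun=> 0); rewrite big1 // => i _; rewrite scale0r.
- move=> _ _ [c ->] [d ->]; exists (fun i => c i + d i).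
  by rewrite -big_split; apply: eq_bigr => i _; rewrite scalerDl.
- move=> a _ [c ->]; exists (fun i => a * c i).
  by rewrite scaler_sumr; apply: eq_bigr => i _; rewrite scalerA.
Qed.

(** A sequence converging to [x] has the limit [x] along every ultrafilter that refines the filter
    of tails. *)
Lemma ultra_closed (S : set X) :
  (forall (V : set_system nat) (v : nat -> X) (M : R), UltraFilter V ->
    (forall n, S (v n)) -> (forall n, rnorm (v n) <= M) ->
    exists2 l, S l & ultra_limit V v l) ->
  forall x, adherent S x -> S x.
Proof.
move=> Slim x ad.
have /choice[v vP] m : exists v, S v /\ rnorm (x - v) <= 1 / m.+1%:R.
  by have [|v vn ve] := ad (1 / m.+1%:R); [rewrite divr_gt0|exists v].
have [V [VV ooV]] := ultraFilterLemma eventually_filter.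
have [m|m|l Sl vl] := Slim V v (rnorm x + 1) VV.
- exact: (vP m).1.
- rewrite -[v m](subrK x) addrC; apply: le_trans (rnormD _ _) (lerD _ _) => //.
  rewrite rnormB; apply: le_trans (vP m).2 _.
  by rewrite ler_pdivrMr // mul1r ler1n.
suff -> : x = l by [].
apply/subr0_eq/rnorm0_eq0/le_anti; rewrite rnorm_ge0 andbT.
apply: (@small_le0 _ _ 2) => r r0 _.
have [N HN] := invS_le 1 r0.
have VN : V [set m | (N <= m)%N] by apply: ooV; exists N.
have [m [/= Nm vm]] := filter_ex (filterI VN (vl _ r0)).
have -> : x - l = (x - v m) + (v m - l) by rewrite addrA subrK.
apply: le_trans (rnormD _ _) _; rewrite mulr2n mulrDr mulr1.
by apply: lerD vm; exact: le_trans (vP m).2 (HN _ Nm).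
Qed.

(** If [e n] is adherent to the span of its predecessors it is redundant; otherwise its distance [d]
    to that span bounds its coefficients by [M / d], and they converge. The induction covers all
    ultrafilters at once, since closedness of the smaller span uses ultrafilters on [nat]. *)
Lemma nspan_ultra_limit n (I : Type) (U : set_system I) (UU : UltraFilter U)
    (x : I -> X) (M : R) :
  (forall i, nspan n (x i)) -> (forall i, rnorm (x i) <= M) ->
  exists2 l, nspan n l & ultra_limit U x l.
Proof.
elim: n I U UU x M => [|n IH] I U UU x M xn xM.
  exists 0; first by exists (fun=> 0); rewrite big_ord0.
  move=> r r0; apply: filterE => i /=; have [c ->] := xn i.
  by rewrite big_ord0 subr0 rnorm0 ltW.
have [n0 nD nZ] := nspan_linear n.
have [ad|nad] := pselect (adherent (nspan n) (e n)).
  have en : nspan n (e n).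
    by apply: ultra_closed ad => V v N VV; exact: IH.
  have sub : nspan n.+1 `<=` nspan n.
    by move=> y /nspanS[a [v [vn ->]]]; apply: nD => //; exact: nZ.
  have [i|i|l ln xl] := IH I U UU x M; [exact/sub|exact: xM|].
  exists l => //; apply/nspanS; exists 0, l.
  by rewrite scale0r add0r.
have [d d0 dP] : exists2 d : R, 0 < d & forall v, nspan n v -> d <= rnorm (e n - v).
  move/existsNP : nad => [d /not_implyP[d0 dP]]; exists d => // v vn.
  by rewrite leNgt; apply/negP => vd; apply: dP; exists v => //; exact: ltW.
have /choice[c /choice[v cvP]] i : exists a v, nspan n v /\ x i = a *: e n + v.
  exact/nspanS.
have cM i : abs (c i) <= M / d.
  have [vn xE] := cvP i; rewrite ler_pdivlMr //; apply: le_trans (xM i).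
  have [->|c0] := eqVneq (c i) 0.
    by rewrite /abs normr0 -(of_real0 R k) of_realK mul0r rnorm_ge0.
  have -> : x i = c i *: (e n - (- (c i)^-1) *: v i).
    by rewrite xE scalerBr scalerA mulrN mulfV // scaleN1r opprK.
  rewrite rnormZ -/(abs _) ler_wpM2l ?abs_ge0 //; apply: dP.
  exact: nZ.
have [g gP] := scalar_ultra_limit UU cM.
have [i|i|w wn wP] := IH I U UU v (M + M / d * rnorm (e n)).
- exact: (cvP i).1.
- have -> : v i = x i - c i *: e n by rewrite (cvP i).2 addrC addKr.
  apply: le_trans (rnormD _ _) (lerD (xM i) _).
  by rewrite rnormN rnormZ -/(abs _) ler_wpM2r ?rnorm_ge0.
exists (g *: e n + w); first by apply/nspanS; exists g, w.
move=> r r0; have e0 : 0 < rnorm (e n) + 1 by rewrite ltr_wpDl ?rnorm_ge0.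
have r1 : 0 < r / 2 / (rnorm (e n) + 1) by rewrite !divr_gt0.
have r2 : 0 < r / 2 by rewrite divr_gt0.
apply: filterS2 (gP _ r1) (wP _ r2) => i /= cg vw.
rewrite (cvP i).2 opprD addrACA -scalerBl (splitr r).
apply: le_trans (rnormD _ _) (lerD _ vw).
rewrite rnormZ -/(abs _); apply: le_trans (ler_wpM2r (rnorm_ge0 _) cg) _.
by rewrite mulrAC ler_pdivrMr // ler_pM2l // lerDl ler01.
Qed.

End Span.

Lemma finite_dimensionalP (X : normedModType K) :
  finite_dimensional X <-> exists n (e : nat -> X), forall x, nspan e n x.
Proof.
split=> [[n [e eX]]|[n [e eX]]].
  exists n, (fun i => if insub i is Some j then e j else 0) => x.
  have [c ->] := eX x.
  exists (fun i => if insub i is Some j then c j else 0).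
  by apply: eq_bigr => i _; rewrite valK.
by exists n, (fun i => e i) => x; have [c ->] := eX x; exists (fun i => c i).
Qed.

Lemma finite_dimensional_ultra_limit (X : normedModType K) (I : Type)
    (U : set_system I) (UU : UltraFilter U) (x : I -> X) (M : R) :
  finite_dimensional X -> (forall i, rnorm (x i) <= M) ->
  exists l, ultra_limit U x l.
Proof.
move=> /finite_dimensionalP[n [e eX]] xM.
by have [l _ xl] := nspan_ultra_limit UU (fun i => eX (x i)) xM; exists l.
Qed.

Lemma nspan_closed (X : normedModType K) (e : nat -> X) n :
  closed_subspace (nspan e n).
Proof.
split; first exact: nspan_linear.
by apply: ultra_closed => V v M VV; exact: nspan_ultra_limit.
Qed.

End UltraLimits.

(** * Finite dimensional spaces *)

Section FiniteDimensionalSummands.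
Variables (R : realType) (k : scalar_kind).
Local Notation K := (scalars R k).

Lemma ultrapower_finite_dimensional (I : Type) (U : set_system I)
    (UU : UltraFilter U) (E : normedModType K) :
  finite_dimensional E -> linearly_isometric E (ultrapower UU E).
Proof.
move=> fE; apply: (@linearly_isometric_intro _ _ _ _ (udiag UU (X := E))).
- exact: udiagP.
- exact: rnorm_udiag.
- move=> q; have [x <-] := ucls_surj q; have /asboolP[M xM] := linftyP x.
  have [l xl] := finite_dimensional_ultra_limit UU fE xM.
  exists l; apply/subr0_eq/rnorm0_eq0/le_anti; rewrite rnorm_ge0 andbT.
  rewrite /udiag -uclsB; apply/ler_addgt0Pr => e e0; rewrite add0r.
  by apply: rnorm_ucls_le; apply: filterS (xl _ e0) => i /=; rewrite rnormB.
Qed.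

(** A bounded family in [E] has a limit along [U], so up to a null family the first coordinate is
    constant. *)
Lemma ultrapower_dsum2 (I : Type) (U : set_system I) (UU : UltraFilter U)
    (E Y : normedModType K) : finite_dimensional E ->
  linearly_isometric (dsum2 E (ultrapower UU Y)) (ultrapower UU (dsum2 E Y)).
Proof.
move=> fE.
have pb (x : E) (y : linfty I Y) :
    (fun i => (x, y i) : dsum2 E Y) \in @bounded_family _ _ _ _.
  have /asboolP[M yM] := linftyP y; apply/asboolP; exists (rnorm x + M) => i.
  rewrite rnorm_dsum2 (le_trans (hypot_ler_norm _ _)) //=.
  by rewrite !ger0_norm ?rnorm_ge0 // lerD2l.
pose p x y : linfty I (dsum2 E Y) := Linfty (pb x y).
have pP a x y x' y' : p (a *: x + x') (a *: y + y') = a *: p x y + p x' y'.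
  exact/val_inj.
have sqn_p x y : sqn (ucls UU (p x y)) = sqn x + sqn (ucls UU y).
  apply: sqn_ucls; under eq_fun do rewrite sqn_dsum2.
  by apply: cvgD; [exact: cvg_cst|exact: sqn_cvg].
have pE x y y' : ucls UU y = ucls UU y' -> ucls UU (p x y) = ucls UU (p x y').
  move=> yy; apply/subr0_eq/sqn_eq0; rewrite -uclsB addrC -scaleN1r -pP sqn_p.
  by rewrite scaleN1r addNr sqn0 add0r uclsP yy scaleN1r addNr sqn0.
have rK (q : ultrapower UU Y) : ucls UU (repr q) = q := reprK q.
apply: (@linearly_isometric_intro _ _ _ _
  (fun z : dsum2 E (ultrapower UU Y) => ucls UU (p z.1 (repr z.2)))).
- move=> a [x q] [x' q'] /=; rewrite -uclsP -pP.
  by apply: pE; rewrite uclsP !rK.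
- move=> z; apply/eqP; rewrite -(eqrXn2 (n := 2)) ?rnorm_ge0 //.
  by rewrite -!/(sqn _) sqn_p sqn_dsum2 rK.
- move=> q; have [z <-] := ucls_surj q; have /asboolP[M zM] := linftyP z.
  have [i|l zl] := @finite_dimensional_ultra_limit _ _ _ _ _ UU (fun i => (z i).1) M fE.
    by apply: le_trans (zM i); rewrite rnorm_dsum2 ler_hypotl ?rnorm_ge0.
  have [i|y yE] := @linfty_ex _ _ _ _ (fun i => (z i).2) M.
    by apply: le_trans (zM i); rewrite rnorm_dsum2 ler_hypotr ?rnorm_ge0.
  exists ((l, ucls UU y) : dsum2 E (ultrapower UU Y)) => /=.
  rewrite (pE _ _ y) ?rK //.
  apply/subr0_eq/rnorm0_eq0/le_anti; rewrite rnorm_ge0 andbT.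
  rewrite -uclsB; apply/ler_addgt0Pr => e e0; rewrite add0r.
  apply: rnorm_ucls_le; apply: filterS (zl _ e0) => i zi.
  suff E1 : rnorm (((l, linfty_val y i) : dsum2 E Y) - z i) = rnorm ((z i).1 - l).
    by apply: le_trans zi; rewrite -E1.
  rewrite yE rnorm_dsum2 /= subrr rnorm0 rnormB /hypot expr0n addr0 sqrtr_sqr.
  by rewrite ger0_norm ?rnorm_ge0.
Qed.

(** The generators must lie in [W] to be pulled back along a linear map with range [W]. A vector [w]
    of [W] outside the smaller span serves to remove the last coordinate of all the others. *)
Lemma subset_nspan_dim (E : normedModType K) (e : nat -> E) n (W : set E) :
  linear_set W -> W `<=` nspan e n ->
  exists f : nat -> E, (forall i, (i < n)%N -> W (f i)) /\ W `<=` nspan f n.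
Proof.
elim: n W => [|n IH] W [W0 WD WZ] We.
  exists (fun=> 0); split=> // x /We[c ->].
  by exists (fun=> 0); rewrite !big_ord0.
have [n0 nD nZ] := nspan_linear e n.
have [|x [Wx xn]|f [fW Wf]] := IH (W `&` nspan e n).
- split=> [//|x y [? ?] [? ?]|a x [? ?]]; split; [exact: WD|exact: nD|exact: WZ|exact: nZ].
- by [].
have [Wn|/existsNP[w /not_implyP[Ww wn]]] := pselect (W `<=` nspan e n).
  exists (fun i => if i == n then 0 else f i); split=> [i|x Wx].
    rewrite ltnS leq_eqVlt; case: eqP => [_ _|_ /= ni]; first exact: W0.
    exact: (fW i ni).1.
  have [c ->] := Wf x (conj Wx (Wn x Wx)).
  apply/nspanS; exists 0, (\sum_(i < n) c i *: f i); rewrite scale0r add0r.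
  by split=> //; exists c; apply: eq_bigr => i _; rewrite ltn_eqF.
have /nspanS[b [v [vn wE]]] := We w Ww.
have b0 : b != 0.
  by apply: contra_notN wn => /eqP b0; rewrite wE b0 scale0r add0r.
exists (fun i => if i == n then w else f i); split=> [i|x Wx].
  rewrite ltnS leq_eqVlt; case: eqP => [_ _|_ /= ni]; first exact: Ww.
  exact: (fW i ni).1.
have /nspanS[a [u [un xE]]] := We x Wx.
pose y := x - (a / b) *: w.
have [|c yE] := Wf y.
  split; first by apply: WD => //; rewrite -scaleNr; exact: WZ.
  rewrite /y xE wE scalerDr scalerA divfK // opprD addrACA subrr add0r.
  by apply: nD => //; rewrite -scaleNr; exact: nZ.
apply/nspanS; exists (a / b), y; rewrite eqxx; split; last by rewrite /y addrC subrK.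
by exists c; rewrite yE; apply: eq_bigr => i _; rewrite ltn_eqF.
Qed.

Lemma finite_dimensional_injective (M E : normedModType K) (g : M -> E) :
  (forall a x y, g (a *: x + y) = a *: g x + g y) -> (forall x, g x = 0 -> x = 0) ->
  finite_dimensional E -> finite_dimensional M.
Proof.
move=> glin g0 /finite_dimensionalP[n [e eE]].
have gz : g 0 = 0.
  by have := glin (-1) 0 0; rewrite scaler0 add0r scaleN1r addNr.
have gZ a x : g (a *: x) = a *: g x by rewrite -[a *: x]addr0 glin gz addr0.
have gD x y : g (x + y) = g x + g y by have := glin 1 x y; rewrite !scale1r.
have [||f [fg gf]] := @subset_nspan_dim E e n (range g).
- split; first by exists 0.
  + by move=> _ _ [x _ <-] [y _ <-]; exists (x + y).
  + by move=> a _ [x _ <-]; exists (a *: x).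
- by move=> x _; exact: eE.
have /choice[h hP] i : exists x, (i < n)%N -> g x = f i.
  have [/fg[x _ <-]|ni] := ltnP i n; first by exists x.
  by exists 0.
apply/finite_dimensionalP; exists n, h => x.
have [c xc] := gf (g x) (imageT g x); exists c.
have gsum : g (\sum_(i < n) c i *: h i) = \sum_(i < n) c i *: f i.
  rewrite (big_morph g gD gz); apply: eq_bigr => i _.
  by rewrite gZ hP.
apply/subr0_eq/g0; rewrite addrC -scaleN1r glin scaleN1r gsum xc.
by rewrite addNr.
Qed.

Lemma orthonormal_infinite (X : normedModType K) (T : Type) (e : T -> X) :
  orthonormal_family e -> embeds nat T -> ~ finite_dimensional X.
Proof.
move=> eo [h hI] fX; have [V [VV ooV]] := ultraFilterLemma eventually_filter.
have [|l el] := @finite_dimensional_ultra_limit _ _ _ _ V VV (e \o h) 1 fX.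
  by move=> i /=; rewrite eo.1.
(* Two members within 1/3 of a limit are at distance at most 2/3, below the separation 1 of the
   family. *)
have e3 : (0 : R) < 3^-1 by rewrite invr_gt0.
have [n /= ln] := filter_ex (el _ e3).
have Vn : V [set m | (n < m)%N] by apply: ooV; exists n.+1.
have [m [/= nm lm]] := filter_ex (filterI Vn (el _ e3)).
have : 1 <= rnorm (e (h n) - e (h m)).
  by apply: orthonormal_inj => // /hI nmE; rewrite nmE ltnn in nm.
have -> : e (h n) - e (h m) = (e (h n) - l) + (l - e (h m)) by rewrite addrA subrK.
have := rnormD (e (h n) - l) (l - e (h m)); rewrite (rnormB l).
by move: ln lm; lra.
Qed.

(** A total family with finitely many indices spans the space, because its span is closed. *)
Lemma infinite_basis (X : normedModType K) (T : Type) (g : T -> X) :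
  total_family g -> ~ finite_dimensional X -> embeds nat T.
Proof.
move=> gt; apply: contra_notP => /infinite_embeds_nat /contrapT[n /card_eqPle[+ _]].
move=> /embeds_setP TI; have [|h hI] := @embeds_trans _ T _ _ TI.
  exact: (embeds_setT T).1.
pose P i t := val (h t) = i.
have /choice[e eP] i : exists x, forall t, P i t -> x = g t.
  have [[t Pt]|nt] := pselect (exists t, P i t); last first.
    by exists 0 => t Pt; exfalso; apply: nt; exists t.
  by exists (g t) => s Ps; congr g; apply/hI/val_inj; rewrite [LHS]Pt Ps.
apply/finite_dimensionalP; exists n, e => x.
have [nl ncl] := nspan_closed e n; have [n0 nD nZ] := nl.
apply: ncl => r r0; have [_ [s _ <-] xs] := gt x r r0; exists (comb g s) => //.
elim: s {xs} => [|p s IH]; first by rewrite /comb big_nil.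
rewrite comb_cons; apply: nD => //; apply: nZ.
have hn : (val (h p.2) < n)%N by have := set_valP (h p.2).
rewrite -(eP (val (h p.2)) p.2 erefl); exists (fun i => (i == val (h p.2))%:R).
rewrite (bigD1 (Ordinal hn)) //= eqxx scale1r big1 ?addr0 // => i /negP ni.
case: eqP => [ih|_]; last by rewrite scale0r.
by exfalso; apply: ni; apply/eqP/val_inj.
Qed.

End FiniteDimensionalSummands.

(** * Density and orthonormal bases of ultrapowers *)

Section Density.
Variables (R : realType) (k : scalar_kind).
Local Notation K := (scalars R k).

Lemma denseP (X : normedModType K) (D : set X) :
  dense D <-> forall x, adherent D x.
Proof.
split=> [dD x e e0|aD O [x Ox] oO].
  have e0' : 0 < of_real k e by rewrite -(of_real0 R k) ltr_of_real.
  have [||d [xd Dd]] := dD (ball x (of_real k e)).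
  - by exists x; exact: ballxx.
  - exact: ball_open.
  exists d => //; move: xd; rewrite -ball_normE /= -rnormE ltr_of_real.
  exact: ltW.
have /nbhs_ballP[r /= r0 rO] : nbhs x O by exact: open_nbhs_nbhs.
have r1 : 0 < real_part r / 2.
  by rewrite divr_gt0 // -(ltr_of_real k) of_real_ge0 ?of_real0 ?ltW.
have [d Dd xd] := aD x _ r1; exists d; split=> //; apply: rO.
rewrite -ball_normE /= -rnormE -[r]of_real_ge0 ?ltW // ltr_of_real.
by apply: le_lt_trans xd _; rewrite ltr_pdivrMr // ltr_pMr ?ltr1n //;
  rewrite -(ltr_of_real k) of_real_ge0 ?of_real0 ?ltW.
Qed.

Lemma dense_iso (X Y : normedModType K) (f : {linear X -> Y}) (D : set X) :
  (forall x, rnorm (f x) = rnorm x) -> (forall y, exists x, f x = y) ->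
  dense D -> dense (f @` D).
Proof.
move=> fn fs /denseP dD; apply/denseP => y e e0; have [x <-] := fs y.
have [d Dd xd] := dD x e e0; exists (f d); first by exists d.
by rewrite -linearB fn.
Qed.

(** The balls of radius 1/3 about the vectors [e t] are disjoint and each meets [D]. *)
Lemma embeds_dense (X : normedModType K) (T : Type) (e : T -> X) (D : set X) :
  orthonormal_family e -> dense D -> embeds T D.
Proof.
move=> eo /denseP dD.
have /choice[d dP] t : exists d : D, rnorm (e t - val d) <= 3^-1.
  have [|d Dd ed] := dD (e t) 3^-1; first by rewrite invr_gt0.
  by exists (SigSub (mem_set Dd)).
exists d => s t st; apply: contrapT => /(orthonormal_inj eo).
have := dP s; have := dP t; rewrite st.
have -> : e s - e t = (e s - val (d t)) + (val (d t) - e t) by rewrite addrA subrK.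
have := rnormD (e s - val (d t)) (val (d t) - e t).
by rewrite (rnormB (val _)); lra.
Qed.

Lemma real_dense (x e : R) : 0 < e -> exists q : rat, `|x - ratr q| <= e.
Proof.
move=> e0; have [|q] := @rat_in_itvoo R (x - e) (x + e).
  by rewrite ltrBlDr -addrA ltrDl addr_gt0.
rewrite in_itv /= => /andP[xq qx]; exists q; rewrite ler_norml.
by apply/andP; split; lra.
Qed.

Lemma scalar_dense : exists r : nat -> K, forall z e, 0 < e ->
  exists n, abs (z - r n) <= e.
Proof.
case: k => [|].
  exists (fun n => if unpickle n is Some q then ratr q else 0) => z e e0.
  have [q zq] := real_dense z e0; exists (pickle q).
  by rewrite pickleK.
exists (fun n => if unpickle n is Some (p, q) then Complex (ratr p) (ratr q) else 0).
move=> [a b] e e0; have e20 : 0 < e / 2 by rewrite divr_gt0.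
have [p ap] := real_dense a e20; have [q bq] := real_dense b e20.
exists (pickle (p, q)); rewrite pickleK (splitr e).
exact: le_trans (sqrtr_le_normD _ _) (lerD ap bq).
Qed.

(** Coefficients are rounded into a countable dense set of scalars, with half of the remaining error
    allowed at each term. *)
Lemma total_dense (X : normedModType K) (T : Type) (g : T -> X) :
  total_family g -> exists2 D : set X, dense D & embeds D (seq (nat * T)).
Proof.
move=> gt; have [r rP] := scalar_dense.
pose c (s : seq (nat * T)) := comb g [seq (r p.1, p.2) | p <- s].
exists (range c); last first.
  have /choice[h hP] (x : range c) : exists s, c s = val x.
    by have [s _ sx] := set_valP x; exists s.
  by exists h => x y xy; apply: val_inj; rewrite -!hP xy.
apply/denseP => x e e0; have e20 : 0 < e / 2 by rewrite divr_gt0.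
have [_ [s _ <-] xs] := gt x _ e20.
have [t st] : exists t, rnorm (comb g s - c t) <= e / 2.
  elim: s (e / 2) e20 {xs} => [|p s IH] d d0.
    by exists [::]; rewrite /c /comb !big_nil subrr rnorm0 ltW.
  have d20 : 0 < d / 2 by rewrite divr_gt0.
  have [t st] := IH _ d20.
  have g0 : 0 < rnorm (g p.2) + 1 by rewrite ltr_wpDl ?rnorm_ge0.
  have [|n pn] := rP p.1 (d / 2 / (rnorm (g p.2) + 1)); first by rewrite divr_gt0.
  exists ((n, p.2) :: t); rewrite /c /= !comb_cons opprD addrACA (splitr d).
  apply: le_trans (rnormD _ _) (lerD _ st).
  rewrite -scalerBl rnormZ -/(abs _).
  apply: le_trans (ler_wpM2r (rnorm_ge0 _) pn) _.
  by rewrite mulrAC ler_pdivrMr // ler_pM2l // lerDl ler01.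
exists (c t); first by exists t.
have -> : x - c t = (x - comb g s) + (comb g s - c t) by rewrite addrA subrK.
by rewrite (splitr e); exact: le_trans (rnormD _ _) (lerD xs st).
Qed.

End Density.

(** * The space of square summable sequences and its unit vectors *)

Section Ell2Basis.
Variables (R : realType) (k : scalar_kind).
Local Notation K := (scalars R k).

Lemma scalars_hilbertian : hilbertian (K^o : normedModType K).
Proof.
rewrite /hilbertian /hvec /sqn; case: k => /= h y.
  by rewrite /rnorm /= !real_normK ?num_real //; ring.
case: h y => [a b] [c d]; rewrite /rnorm /= !sqr_sqrtr ?addr_ge0 ?sqr_ge0 //.
by ring.
Qed.

Lemma sqn_ell2_cvg (x : ell2 R k) :
  series (fun n => sqn (x n : K^o)) @ \oo --> sqn x.
Proof.
have /asboolP xc := ell2P x.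
suff -> : sqn x = limn (series (fun n => sqn (x n : K^o))) by [].
rewrite /sqn /rnorm -[`|x|]/(ell2_norm x) /ell2_norm of_realK sqr_sqrtr //.
by apply: limr_ge => //; apply: filterE => n; exact: series_sqr_ge0.
Qed.
Arguments sqn_ell2_cvg : clear implicits.

Lemma sqn_ell2_eq (x y : ell2 R k) :
  (forall n, sqn (x n : K^o) = sqn (y n : K^o)) -> sqn x = sqn y.
Proof.
move=> xy; have xc := sqn_ell2_cvg x; have yc := sqn_ell2_cvg y.
rewrite -(cvg_lim _ xc) // -(cvg_lim _ yc) //; congr (limn (series _)).
exact/funext.
Qed.

Lemma ell2_hilbertian : hilbertian (ell2 R k).
Proof.
move=> h y.
have h1 : series (fun n => sqn ((y + h) n : K^o)) n +
    series (fun n => sqn ((y - h) n : K^o)) n @[n --> \oo] --> sqn (y + h) + sqn (y - h).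
  by apply: cvgD; exact: sqn_ell2_cvg.
have h2 : 2 * (series (fun n => sqn (y n : K^o)) n +
    series (fun n => sqn (h n : K^o)) n) @[n --> \oo] --> 2 * (sqn y + sqn h).
  by apply: cvgMr; apply: cvgD; exact: sqn_ell2_cvg.
rewrite -(cvg_lim _ h1) // -(cvg_lim _ h2) //; congr (lim (_ @ \oo)).
apply/funext => n; rewrite /series /= -!big_split mulr_sumr.
by apply: eq_bigr => i _; exact: scalars_hilbertian.
Qed.

Definition unit_seq (n : nat) : nat -> K^o := fun m => (m == n)%:R.

Lemma partial_norm_unit n m : partial_norm (unit_seq n) m = (n < m)%:R.
Proof.
have r1 (b : bool) : rnorm (b%:R : K^o) = b%:R.
  by case: b; rewrite ?rnorm0 //; exact: abs1.
elim: m => [|m IH]; first by rewrite partial_norm0.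
rewrite partial_normS IH r1 /hypot ltnS; case: (ltngtP n m) => _.
- by rewrite expr1n expr0n addr0 sqrtr1.
- by rewrite expr0n addr0 sqrtr0.
- by rewrite expr1n expr0n add0r sqrtr1.
Qed.

Lemma unit_seq_summable n : unit_seq n \in @square_summable R k.
Proof.
apply/square_summableP; exists 1 => m; rewrite partial_norm_unit.
by rewrite lern1 leq_b1.
Qed.

Definition ell2_unit n : ell2 R k := Ell2 (unit_seq_summable n).

Lemma ell2_unit_orthonormal : orthonormal_family ell2_unit.
Proof.
split=> [n|n m nm a b].
  apply/le_anti/andP; split.
    by apply: ell2_norm_le => m; rewrite partial_norm_unit lern1 leq_b1.
  apply: le_trans (partial_norm_le_ell2 _ n.+1).
  by rewrite partial_norm_unit ltnSn.
(* It remains to see that changing the sign of [b] preserves the norm: at each coordinate one of the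
   two terms vanishes. *)
apply/eqP; rewrite /rform mulf_eq0 subr_eq0; apply/orP; left; apply/eqP.
apply: sqn_ell2_eq => i.
have -> : (a *: ell2_unit n + b *: ell2_unit m) i =
  a * (i == n)%:R + b * (i == m)%:R by [].
have -> : (a *: ell2_unit n - b *: ell2_unit m) i =
  a * (i == n)%:R - b * (i == m)%:R by [].
have [->|_] := eqVneq i m; last by rewrite mulr0 subr0 addr0.
have /negPf -> : m != n by apply/eqP => mn; exact: nm.
by rewrite mulr0 add0r sub0r sqnN.
Qed.

End Ell2Basis.

(** * Orthonormal families in ultrapowers and their cardinality *)

Section UltrapowerBasis.
Variables (R : realType) (k : scalar_kind).
Local Notation K := (scalars R k).

Lemma embeds_bool_fun (A B : Type) : embeds A B -> embeds (A -> bool) (B -> bool).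
Proof.
move=> [j jI]; exists (fun P b => `[< exists2 a, j a = b & P a >]) => P Q PQ.
apply/funext => a; apply/idP/idP => Pa; have := congr1 (@^~ (j a)) PQ => /=.
  by move/esym => E; have /asboolP[a' /jI <-] : `[< exists2 a', j a' = j a & Q a' >]
    by rewrite E; apply/asboolP; exists a.
by move=> E; have /asboolP[a' /jI <-] : `[< exists2 a', j a' = j a & P a' >]
    by rewrite E; apply/asboolP; exists a.
Qed.

Lemma embeds_fun_graph (A B : Type) : embeds (A -> B) (A * B -> bool).
Proof.
exists (fun f p => `[< f p.1 = p.2 >]) => f g fg; apply/funext => a.
have := congr1 (@^~ (a, f a)) fg => /= /esym E.
by have /asboolP -> : `[< g a = f a >] by rewrite E; exact/asboolP.
Qed.

Lemma embeds_funr (A B C : Type) : embeds B C -> embeds (A -> B) (A -> C).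
Proof.
move=> [j jI]; exists (fun f => j \o f) => f g fg; apply/funext => a.
by apply: jI; exact: (congr1 (@^~ a) fg).
Qed.

(** Lists containing a given list form a filter base, by concatenation. Regularity lies in this: a
    list belongs to only finitely many of the sets indexed by [a], yet each of them is in [U]. *)
Lemma regular_ultrafilter (A : eqType) : exists U : set_system (seq A),
  UltraFilter U /\ forall a, U [set s : seq A | a \in s].
Proof.
pose B (s : seq A) := [set t : seq A | {subset s <= t}].
have FB : ProperFilter (filter_from [set: seq A] B).
  apply: filter_from_proper; last by move=> s _; exists s; exact: subset_refl.
  apply: filter_from_filter; first by exists [::].
  move=> s t _ _; exists (s ++ t) => // u stu.
  by split=> a ain; apply: stu; rewrite mem_cat ain ?orbT.
have [U [UU FU]] := ultraFilterLemma FB.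
exists U; split=> // a; apply: FU; exists [:: a] => // s; apply.
exact: mem_head.
Qed.

Lemma orthonormal_ultrapower (I : Type) (U : set_system I) (UU : UltraFilter U)
    (X : normedModType K) (T S : Type) (e : T -> X) (f : S -> I -> T) :
  orthonormal_family e ->
  (forall s t, s <> t -> U [set i | f s i <> f t i]) ->
  exists g : S -> ultrapower UU X, orthonormal_family g.
Proof.
move=> eo fU.
have /choice[u uE] s : exists u : linfty I X, linfty_val u = e \o f s.
  by apply: (@linfty_ex _ _ _ _ _ 1) => i /=; rewrite eo.1.
exists (fun s => ucls UU (u s)); split=> [s|s t st a b].
  apply: (ultra_cvg_unique UU) (rnorm_cvg UU (u s)) _; rewrite uE /=.
  by under eq_fun do rewrite eo.1; exact: cvg_cst.
apply/eqP; rewrite /rform mulf_eq0 subr_eq0; apply/orP; left; apply/eqP.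
have uclsZD c d : c *: ucls UU (u s) + d *: ucls UU (u t) =
    ucls UU (c *: u s + d *: u t).
  rewrite uclsP; congr (_ + _); apply: (addIr (ucls UU 0)).
  by rewrite -uclsP -uclsD !addr0.
rewrite -scaleNr !uclsZD.
apply: (ultra_cvg_unique UU) (sqn_cvg UU (a *: u s + b *: u t)) _.
apply: cvg_trans (sqn_cvg UU (a *: u s + (- b) *: u t)).
apply: near_eq_cvg; apply: filterS (fU s t st) => i /= fst.
have := eo.2 _ _ fst a b => /eqP; rewrite /rform mulf_eq0 invr_eq0 pnatr_eq0 orbF.
rewrite subr_eq0 => /eqP ab.
suff : sqn (a *: linfty_val (u s) i + (- b) *: linfty_val (u t) i) =
    sqn (a *: linfty_val (u s) i + b *: linfty_val (u t) i) by [].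
by rewrite !uE /= scaleNr.
Qed.

(* Take the regular ultrafilter on lists: the coordinates e_n, with n a code of
   the restriction of P to the list, separate the subsets P of A. *)
Lemma ultrapower_basis (A : Type) : embeds nat A ->
  exists (I : Type) (U : set_system I) (UU : UltraFilter U),
    (forall (X : normedModType K) (e : nat -> X), orthonormal_family e ->
      exists g : (A -> bool) -> ultrapower UU X, orthonormal_family g) /\
    forall (X : completeNormedModType K) (e : nat -> X),
      hilbertian X -> orthonormal_family e -> embeds X A ->
      exists (B : Type) (g : B -> ultrapower UU X),
        [/\ orthonormal_family g, total_family g,
          embeds B (A -> bool) & embeds (A -> bool) B].
Proof.
move=> natA; have [U [UU AU]] := regular_ultrafilter {classic A}.
exists (seq {classic A}), U, UU.
have fam (X : normedModType K) (e : nat -> X) : orthonormal_family e ->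
    exists g : (A -> bool) -> ultrapower UU X, orthonormal_family g.
  move=> eo; apply: (@orthonormal_ultrapower _ _ UU X nat _ e
    (fun (P : A -> bool) (s : seq {classic A}) => pickle [seq P a | a <- s]) eo).
  move=> P Q PQ; have [a Pa] : exists a, P a <> Q a.
    by apply: contrapT => /forallNP h; apply: PQ; apply/funext => a;
      apply: contrapT; exact: h.
  apply: filterS (AU a) => s /= sa /(pcan_inj pickleK) PQs.
  exact: Pa ((@eq_in_map {classic A} bool P Q s).2 PQs a sa).
split=> // X e hX eo XA; have [g go] := fam _ _ eo.
have [B [b [bo bt AB BX]]] :=
  orthonormal_basis_above (hilbertian_ultrapower (UU := UU) hX) go.
(* Upper bound by counting points: the basis is no larger than the set of maps from lists over [A]
   to [A], and the graphs of these are subsets of a set no larger than [A]. *)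
exists B, b; split=> //; apply: embeds_trans BX _.
apply: (embeds_trans (embeds_ultrapower UU X)).
apply: (embeds_trans (embeds_funr _ XA)).
apply: (embeds_trans (embeds_fun_graph _ _)).
apply: embeds_bool_fun; apply: embeds_trans (embeds_square natA).
exact: embeds_prod (embeds_seq natA) (embeds_refl _).
Qed.

End UltrapowerBasis.

(** * The elementary class *)

Section ElementaryClass.
Variables (R : realType) (k : scalar_kind).
Local Notation K := (scalars R k).

Definition hpart_trivial (X : normedModType K) : Prop :=
  forall x : X, hvec x -> x = 0.

Definition linear_map (X Y : normedModType K) (f : X -> Y) : Prop :=
  forall a x y, f (a *: x + y) = a *: f x + f y.

(** The law for [f h] is tested on the vectors [f y] alone. With the diagonal embedding for [f],
    this brings Hilbertian vectors down from an ultrapower. *)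
Lemma hvec_reflect (X Y : normedModType K) (f : X -> Y) (h : X) :
  linear_map f -> (forall x, rnorm (f x) = rnorm x) -> hvec (f h) -> hvec h.
Proof.
move=> flin fn hh y; have fq x : sqn (f x) = sqn x by rewrite /sqn fn.
have := flin 1 y h; have := flin (-1) h y.
rewrite !scaleN1r !scale1r (addrC (- h)) (addrC (- f h)) => fB fD.
by rewrite -!fq fD fB hh.
Qed.

Lemma orthonormal_map (T : Type) (X Y : normedModType K) (f : X -> Y) (e : T -> X) :
  linear_map f -> (forall x, rnorm (f x) = rnorm x) ->
  orthonormal_family e -> orthonormal_family (f \o e).
Proof.
move=> flin fn [e1 eo]; split=> [t|s t st a b]; first by rewrite /= fn e1.
have f0 : f 0 = 0 by apply: rnorm0_eq0; rewrite fn rnorm0.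
have fZ c x : f (c *: x) = c *: f x by rewrite -[c *: x]addr0 flin f0 addr0.
have fD c d x y : sqn (c *: f x + d *: f y) = sqn (c *: x + d *: y).
  by rewrite -(fZ d) -flin /sqn fn.
by have := eo s t st a b; rewrite /rform /= -!(scaleNr b) !fD.
Qed.

Lemma dsum2_inr_linear (X Y : normedModType K) :
  linear_map (fun y : Y => (0, y) : dsum2 X Y).
Proof. by move=> a x y; congr pair; rewrite /= scaler0 addr0. Qed.

Lemma rnorm_dsum2_inr (X Y : normedModType K) (y : Y) :
  rnorm ((0, y) : dsum2 X Y) = rnorm y.
Proof.
rewrite rnorm_dsum2 /= rnorm0 /hypot expr0n add0r sqrtr_sqr.
by rewrite ger0_norm ?rnorm_ge0.
Qed.

Lemma orthonormal_inr (T : Type) (X Y : normedModType K) (e : T -> Y) :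
  orthonormal_family e ->
  orthonormal_family (fun t => (0, e t) : dsum2 X Y).
Proof.
exact: (orthonormal_map (@dsum2_inr_linear X Y) (@rnorm_dsum2_inr X Y)).
Qed.

(** Both facts about [M] are used: [hpart_trivial M] in the cancellation of summands, and the
    statement on [hvec (f x)], relative to [X], in embedding [M] in [E]. *)
Lemma hilbert_splitting (X : completeNormedModType K) :
  exists M N : completeNormedModType K,
    [/\ hilbertian N, hpart_trivial M, linearly_isometric (dsum2 M N) X,
      exists f : M -> X, [/\ linear_map f, forall x, f x = 0 -> x = 0 &
        forall x, hvec (f x) -> x = 0] &
      exists f : N -> X, linear_map f /\ forall x, f x = 0 -> x = 0].
Proof.
have cN := hvec_closed X; have hN : [set h : X | hvec h] `<=` [set h | hvec h] by [].
pose cM := orthogonal_closed cN hN.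
exists (banach_subspace cM), (banach_subspace cN).
(* Such a vector is orthogonal to itself. *)
have M0 (x : banach_subspace cM) : hvec (subspace_val x) -> x = 0.
  move=> hx; apply: sqn_eq0; rewrite -[sqn x]/(sqn (subspace_val x)) -rform_diag.
  exact: (subspace_valP x).
split.
- by move=> h y; exact: (subspace_valP h).
(* A vector Hilbertian in [M] is Hilbertian in [X]: the component [p] of [y] contributes [sqn p] to
   each of the squares involving [y]. *)
- move=> x hx; apply: M0 => y; have [p hp po] := projection cN hN y.
  have [z zE] := subspace_ex cM po.
  have sqnE (w : banach_subspace cM) : sqn (subspace_val w + p) = sqn w + sqn p.
    by rewrite sqn_rformD // (subspace_valP w) // mulr0 addr0.
  have -> : y = subspace_val z + p by rewrite zE subrK.
  rewrite addrAC [_ - _]addrAC; have := hx z.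
  have := sqnE (z + x); have := sqnE (z - x); have := sqnE z.
  rewrite /= => -> -> ->; lra.
- exact: orthogonal_decomposition.
- by exists (fun x => subspace_val x); split=> // x x0; exact: val_inj.
- by exists (fun x => subspace_val x); split=> // x x0; exact: val_inj.
Qed.

Lemma hvec_dsum2_inl (X Y : normedModType K) (x : X) (y : Y) :
  hvec ((x, y) : dsum2 X Y) -> hvec y -> hvec x.
Proof.
move=> hxy hy z; have := hxy (z, 0); have := hy 0.
by rewrite !sqn_dsum2 /= sqn0 add0r sub0r sqnN; lra.
Qed.

(* The isometry preserves the set of Hilbertian vectors, which is the second
   summand on both sides, and its orthogonal, which is the first one. *)
Lemma dsum2_cancel (A B H G : normedModType K) :
  hpart_trivial A -> hpart_trivial B -> hilbertian H -> hilbertian G ->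
  linearly_isometric (dsum2 A H) (dsum2 B G) -> linearly_isometric A B.
Proof.
move=> A0 B0 hH hG /linearly_isometric_elim[f [fn fs]].
have in2 (X Y : normedModType K) (z : dsum2 X Y) : hpart_trivial X -> hilbertian Y ->
    hvec z <-> z.1 = 0.
  move=> X0 hY; split=> [hz|z1]; last by apply: hvec_dsum2; rewrite ?z1 //; exact: hvec0.
  by apply: X0; apply: (@hvec_dsum2_inl X Y z.1 z.2) => //; case: z hz.
have fq z : sqn (f z) = sqn z by rewrite /sqn fn.
have f2 (h : H) : (f (0, h)).1 = 0.
  by apply/(in2 _ _ _ B0 hG)/(hvec_iso _ fn fs)/(in2 _ _ _ A0 hH).
have f2s (g : G) : exists h, f (0, h) = (0, g).
  have [[a h] fah] := fs (0, g); suff a0 : a = 0 by exists h; rewrite -a0.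
  by apply: (in2 _ _ ((a, h) : dsum2 A H) A0 hH).1;
    apply/(hvec_iso _ fn fs); rewrite fah; apply/(in2 _ _ _ B0 hG).
(* Adding the vector [(0, h)] whose image cancels the second component lowers the squared norm of
   the image by [sqn h] but raises that of the source by [sqn h]. *)
have f1 (a : A) : (f (a, 0)).2 = 0.
  have [h fh] := f2s (- (f (a, 0)).2).
  have := fq ((a, 0) : dsum2 A H); have := fq ((0, h) : dsum2 A H).
  have := fq (((a, 0) : dsum2 A H) + (0, h)).
  rewrite linearD fh !sqn_dsum2 /= !(addr0, add0r, subrr, sqn0, sqnN) => -> <- aE.
  apply: sqn_eq0; have := sqn_ge0 (f (a, 0)).2; lra.
apply: (@linearly_isometric_intro _ _ _ _ (fun a => (f (a, 0)).1)).
- move=> c a b; have -> : ((c *: a + b, 0) : dsum2 A H) = c *: (a, 0) + (b, 0).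
    by congr pair; rewrite /= scaler0 addr0.
  by rewrite linearP.
- move=> a; apply/eqP; rewrite -(eqrXn2 (n := 2)) ?rnorm_ge0 // -!/(sqn _); apply/eqP.
  have := fq ((a, 0) : dsum2 A H); by rewrite !sqn_dsum2 f1 /= !sqn0 !addr0.
- move=> b; have [[a h] fah] := fs (b, 0).
  have f20 : (f (0, h)).2 = 0.
    have := congr1 snd fah.
    have -> : ((a, h) : dsum2 A H) = (a, 0) + (0, h).
      by congr pair; rewrite /= ?addr0 ?add0r.
    by rewrite linearD /= f1 add0r.
  have h0 : h = 0.
    apply: sqn_eq0; have := fq ((0, h) : dsum2 A H).
    by rewrite !sqn_dsum2 f2 f20 /= !sqn0 !add0r.
  by exists a; rewrite -h0 fah.
Qed.

Lemma finite_dimensional_dsum2 (X Y : normedModType K) :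
  finite_dimensional X -> finite_dimensional Y -> finite_dimensional (dsum2 X Y).
Proof.
move=> [n [e eX]] [m [f fY]].
exists (n + m)%N, (fun i => match fintype.split i with
  inl j => (e j, 0) | inr j => (0, f j) end) => -[x y].
have [c ->] := eX x; have [d ->] := fY y.
exists (fun i => match fintype.split i with inl j => c j | inr j => d j end).
have sl (i : 'I_n) : fintype.split (lshift m i) = inl i := unsplitK (inl i).
have sr (i : 'I_m) : fintype.split (rshift n i) = inr i := unsplitK (inr i).
rewrite big_split_ord /=.
have -> : ((\sum_(i < n) c i *: e i, \sum_(i < m) d i *: f i) : dsum2 X Y) =
    (\sum_(i < n) c i *: e i, 0) + (0, \sum_(i < m) d i *: f i).
  by congr pair; rewrite /= ?addr0 ?add0r.
congr (_ + _).
  transitivity (\sum_(i < n) c i *: ((e i, 0) : dsum2 X Y)).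
    elim/big_rec2: _ => // i u v _ <-; congr pair; by rewrite /= scaler0 addr0.
  by apply: eq_bigr => i _; rewrite sl.
transitivity (\sum_(i < m) d i *: ((0, f i) : dsum2 X Y)).
  elim/big_rec2: _ => // i u v _ <-; congr pair; by rewrite /= scaler0 addr0.
by apply: eq_bigr => i _; rewrite sr.
Qed.

(** A basis of [F] embeds in [nat], since otherwise it would be infinite, and an infinite index set
    absorbs a copy of [nat]. *)
Lemma hilbertian_absorb (F N : completeNormedModType K) :
  hilbertian F -> hilbertian N -> finite_dimensional F -> ~ finite_dimensional N ->
  linearly_isometric (dsum2 F N) N.
Proof.
move=> hF hN fF nN; have [B [b [bo bt]]] := orthonormal_basis hF.
have [C [c [co ct]]] := orthonormal_basis hN; have natC := infinite_basis ct nN.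
have BC : embeds (B + C) C.
  apply: embeds_trans (embeds_nat_sum natC); apply: embeds_sum (embeds_refl _).
  by have [//|natB] := embeds_total B nat; case: (orthonormal_infinite bo natB fF).
apply: (orthonormal_card_isometry (hilbertian_dsum2 hF hN) hN
  (orthonormal_sum bo co) co (total_sum bt ct) ct BC).
by exists inr => x y [].
Qed.

Lemma elementary_class_sub (E X : completeNormedModType K) :
  finite_dimensional E -> elementary_class (dsum2 E (ell2 R k)) X ->
  exists H : completeNormedModType K,
    [/\ hilbertian H, ~ finite_dimensional H & linearly_isometric X (dsum2 E H)].
Proof.
move=> fE [I [U [UU [J [V [VV XE]]]]]].
pose Y : completeNormedModType K := ultrapower VV (ell2 R k).
have hY : hilbertian Y by apply: hilbertian_ultrapower; exact: ell2_hilbertian.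
have XY : linearly_isometric (ultrapower UU X) (dsum2 E Y).
  exact: linearly_isometric_trans XE (linearly_isometric_sym (ultrapower_dsum2 VV _ fE)).
(* A finite dimensional [X] would equal its ultrapower, which contains an infinite orthonormal
   family; this is what makes [N] infinite dimensional. *)
have nX : ~ finite_dimensional X.
  move=> fX; have bo := orthonormal_map (udiagP VV (X := ell2 R k))
    (rnorm_udiag VV (X := ell2 R k)) (@ell2_unit_orthonormal R k).
  apply: (orthonormal_infinite (orthonormal_inr E bo)).
    exact: embeds_refl.
  apply: finite_dimensional_iso XY _.
  exact: finite_dimensional_iso (ultrapower_finite_dimensional UU fX) fX.
have [M [N [hN M0 MN [f [flin _ f0]] _]]] := hilbert_splitting X.
have [g [gn gs]] := linearly_isometric_elim XY.
have fM : finite_dimensional M.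
  apply: (@finite_dimensional_injective _ _ M E
    (fun m => (g (udiag UU (f m))).1) _ _ fE).
    by move=> a x y; rewrite flin udiagP linearP.
  move=> m gm0; apply: f0.
  apply: (hvec_reflect (f := fun x => g (udiag UU x))).
  - by move=> a x y; rewrite udiagP linearP.
  - by move=> x; rewrite gn rnorm_udiag.
  - by apply: hvec_dsum2; [rewrite gm0; exact: hvec0|exact: hY].
have MU : linearly_isometric (dsum2 M (ultrapower UU N)) (dsum2 E Y).
  apply: linearly_isometric_trans (ultrapower_dsum2 UU _ fM) _.
  exact: linearly_isometric_trans (ultrapower_iso UU MN) XY.
have [E1 [F [hF E10 EF _ [e [elin e0]]]]] := hilbert_splitting E.
have fF : finite_dimensional F := finite_dimensional_injective elin e0 fE.
have ME : linearly_isometric M E1.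
  apply: (dsum2_cancel M0 E10 (hilbertian_ultrapower (UU := UU) hN)
    (hilbertian_dsum2 hF hY)).
  apply: linearly_isometric_trans MU _.
  apply: linearly_isometric_trans (linearly_isometric_sym (dsum2A _ _ _)).
  exact: dsum2_iso (linearly_isometric_sym EF) (linearly_isometric_refl _).
have nN : ~ finite_dimensional N.
  move=> fN; apply: nX; apply: finite_dimensional_iso MN _.
  exact: finite_dimensional_dsum2.
exists N; split=> //.
apply: linearly_isometric_trans (linearly_isometric_sym MN) _.
apply: linearly_isometric_trans (dsum2_iso ME (linearly_isometric_refl _)) _.
apply: (@linearly_isometric_trans _ _ (dsum2 E1 (dsum2 F N))).
  apply: dsum2_iso (linearly_isometric_refl _) _.
  exact/linearly_isometric_sym/hilbertian_absorb.
apply: linearly_isometric_trans (dsum2A _ _ _) _.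
exact: dsum2_iso EF (linearly_isometric_refl _).
Qed.

Lemma elementary_class_sup (E X H : completeNormedModType K) :
  finite_dimensional E -> hilbertian H -> ~ finite_dimensional H ->
  linearly_isometric X (dsum2 E H) -> elementary_class (dsum2 E (ell2 R k)) X.
Proof.
move=> fE hH nH XE; have [B [b [bo bt]]] := orthonormal_basis hH.
have [j jI] := infinite_basis bt nH.
have b'o := orthonormal_reindex jI bo; have uo := @ell2_unit_orthonormal R k.
(* Large enough to receive both spaces, so that a single ultrafilter gives both ultrapowers bases of
   the same cardinality. *)
pose A := (H * ell2 R k)%type.
have HA : embeds H A by exists (fun x => (x, 0)) => x y [].
have lA : embeds (ell2 R k) A by exists (fun x => (0, x)) => x y [].
have natA : embeds nat A.
  apply: embeds_trans lA; exists (@ell2_unit R k) => m n mn.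
  apply: contrapT => /(orthonormal_inj uo).
  by rewrite mn subrr rnorm0 ler10.
have [I [U [UU [_ basis]]]] := ultrapower_basis R k natA.
have [C [c [co ct CA AC]]] := basis H _ hH b'o HA.
have [D [d [do_ dt DA AD]]] := basis _ _ (@ell2_hilbertian R k) uo lA.
have hUH := hilbertian_ultrapower (UU := UU) hH.
have hUl := hilbertian_ultrapower (UU := UU) (@ell2_hilbertian R k).
exists I, U, UU, I, U, UU.
apply: linearly_isometric_trans (ultrapower_iso UU XE) _.
apply: linearly_isometric_trans (linearly_isometric_sym (ultrapower_dsum2 UU _ fE)) _.
apply: linearly_isometric_trans (ultrapower_dsum2 UU _ fE).
apply: dsum2_iso (linearly_isometric_refl _) _.
apply: (orthonormal_card_isometry hUH hUl co do_ ct dt).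
  exact: embeds_trans CA AD.
exact: embeds_trans DA AC.
Qed.

(** Rather than building square summable families over [T], the space is found in an ultrapower of
    [ell2]: it is the closed span of the vectors indexed by the singletons of [T]. *)
Lemma hilbertian_dimension_ex (T : Type) : embeds nat T ->
  exists (H : completeNormedModType K) (e : T -> H),
    [/\ hilbertian H, orthonormal_family e & total_family e].
Proof.
move=> natT; have [I [U [UU [fam _]]]] := ultrapower_basis R k natT.
have [g go] := fam _ _ (@ell2_unit_orthonormal R k).
pose e0 (t : T) := g (fun s => `[< s = t >]).
have e0o : orthonormal_family e0.
  apply: (orthonormal_reindex _ go) => s t st.
  have := congr1 (@^~ s) st => /= E.
  by have /asboolP : `[< s = t >] by rewrite -E; exact/asboolP.
have cS := closure_subspace (comb_linear_set e0).
have /choice[e eE] t : exists u : banach_subspace cS, subspace_val u = e0 t.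
  by apply: subspace_ex => r r0; exists (e0 t);
    [exact: comb_mem|rewrite subrr rnorm0 ltW].
have valcomb s : subspace_val (comb e s) = comb e0 s.
  elim: s => [|p s IH]; first by rewrite /comb !big_nil.
  by rewrite !comb_cons -IH -eE.
have hU := hilbertian_ultrapower (UU := UU) (@ell2_hilbertian R k).
exists (banach_subspace cS), e; split.
- by move=> h y; exact: (hU (subspace_val h) (subspace_val y)).
- split=> [t|s t st a b]; first by rewrite rnorm_subspace eE e0o.1.
  have := e0o.2 s t st a b; rewrite -!eE; exact.
- move=> x r r0; have [_ [s _ <-] xs] := subspace_valP x r r0.
  exists (comb e s); first by exists s.
  by rewrite -valcomb in xs; exact: xs.
Qed.

Lemma dense_dsum2 (E H : completeNormedModType K) (T : Type) (e : T -> H) :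
  finite_dimensional E -> total_family e -> embeds nat T ->
  exists2 D : set (dsum2 E H), dense D & embeds D T.
Proof.
move=> /finite_dimensionalP[n [f fE]] et natT.
have ft : total_family f.
  move=> x r r0; exists x; last by rewrite subrr rnorm0 ltW.
  have [c ->] := fE x; exists [seq (c i, i) | i <- iota 0 n] => //.
  by rewrite /comb big_map -{1}[n]subn0 -/(index_iota 0 n) big_mkord.
have [D dD DT] := total_dense (total_sum ft et); exists D => //.
apply: embeds_trans DT (embeds_trans _ (embeds_seq natT)).
have nTT : embeds (nat * (nat + T)) T.
  apply: embeds_trans (embeds_prod natT (embeds_nat_sum natT)) _.
  exact: embeds_square.
have [h hI] := nTT; exists (map h); exact: inj_map.
Qed.

Lemma categorical_dsum2 (E : completeNormedModType K) (kappa : Type) :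
  finite_dimensional E -> infinite_set [set: kappa] ->
  categorical kappa (dsum2 E (ell2 R k)).
Proof.
move=> fE /infinite_embeds_nat natk.
have [H [e [hH eo et]]] := hilbertian_dimension_ex natk.
have nH : ~ finite_dimensional H := orthonormal_infinite eo natk.
have lower (D : set (dsum2 E H)) : dense D -> embeds kappa D.
  exact/embeds_dense/(orthonormal_inr E eo).
exists (dsum2 E H); split.
- apply: (elementary_class_sup fE hH nH); exact: linearly_isometric_refl.
- split.
    have [D dD Dk] := dense_dsum2 fE et natk; exists D => //.
    apply/card_eqPle; split; apply/embeds_setP.
      by apply: embeds_trans Dk (embeds_setT _).1.
    by apply: embeds_trans (embeds_setT _).2 (lower _ dD).
  move=> D dD; apply/embeds_setP.
  exact: embeds_trans (embeds_setT _).2 (lower _ dD).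
- move=> Z Zclass [[D dD Dk] Dmin].
  have [G [hG nG ZG]] := elementary_class_sub fE Zclass.
  have [B [b [bo bt]]] := orthonormal_basis hG; have natB := infinite_basis bt nG.
  apply: linearly_isometric_trans (ZG) (dsum2_iso (linearly_isometric_refl _) _).
  have [f [fn fs]] := linearly_isometric_elim ZG.
  have [g [gn gs]] := linearly_isometric_elim (linearly_isometric_sym ZG).
  have image_embeds (X Y : Type) (h : X -> Y) (A : set X) : embeds (h @` A) A.
    exact/embeds_setP/card_image_le.
  (* The basis [B] embeds in the image of the dense set [D], of size [kappa]; conversely a dense set
     no larger than [B], carried back to [Z], is at least as large as [kappa]. *)
  apply: (orthonormal_card_isometry hG hH bo eo bt et).
    apply: embeds_trans (embeds_dense (orthonormal_inr E bo) (dense_iso fn fs dD)) _.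
    apply: embeds_trans (image_embeds _ _ _ _) _.
    apply: embeds_trans (embeds_setT kappa).2.
    by have /card_eqPle[/embeds_setP] := Dk.
  have [D' dD' D'B] := dense_dsum2 fE bt natB.
  have /embeds_setP kD := Dmin _ (dense_iso gn gs dD').
  apply: embeds_trans (embeds_setT kappa).1 (embeds_trans kD _).
  exact: embeds_trans (image_embeds _ _ _ _) D'B.
Qed.

End ElementaryClass.

Theorem corollary6p4 (R : realType) (k : scalar_kind)
    (E : completeNormedModType (scalars R k)) (finE : finite_dimensional E) :
  (forall X : completeNormedModType (scalars R k),
     elementary_class (dsum2 E (ell2 R k)) X <->
     exists H : completeNormedModType (scalars R k),
       [/\ hilbert_space H, ~ finite_dimensional H &
           linearly_isometric X (dsum2 E H)]) /\
  totally_categorical (dsum2 E (ell2 R k)).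
Proof.
split=> [X|kappa kinf]; last exact: categorical_dsum2.
split=> [/(elementary_class_sub finE)[H [hH nH XH]]|[H [/hilbert_spaceP hH nH XH]]].
  by exists H; split=> //; exact/hilbert_spaceP.
exact: elementary_class_sup XH.
Qed.
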